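(* Let $0<\alpha\le 1$. Let $\mathcal{G}_2\subset C^{\alpha+}_0(\Sigma^+,\mathbb{R})$ be the set of those $A\in C^{\alpha+}_0(\Sigma^+,\mathbb{R})$ for which there is a unique maximizing measure, which is supported on a periodic orbit and is locally constant; that is, there are a periodic point $p\in\Sigma^+$ and a neighbourhood $\mathcal{U}\ni A$ in $C^{\alpha+}_0(\Sigma^+,\mathbb{R})$ such that for all $B\in\mathcal{U}$ the unique maximizing measure for $B$ is $\nu_p$. Then $\mathcal{G}_2$ is open and dense in $C^{\alpha+}_0(\Sigma^+,\mathbb{R})$.
   Context: $\Sigma^+$ is a one-sided topologically mixing subshift of finite type (the sequences $\mathbf{x}=(x_0,x_1,\ldots)$ over a finite alphabet all of whose consecutive pairs $(x_i,x_{i+1})$ are allowed by a 0-1 transition matrix), with shift map $\sigma:\Sigma^+\to\Sigma^+$. Fix $\lambda>1$ and endow $\Sigma^+$ with the metric $d(\mathbf{x},\mathbf{y})=\lambda^{-n}$, $n=\min\{k\ge 0: x_k\ne y_k\}$ (and $d(\mathbf{x},\mathbf{x})=0$). For an exponent $\alpha$ write $\mathrm{Hold}_\alpha(A)=\sup_{0<d(x,y)\le 1}\frac{|A(x)-A(y)|}{d(x,y)^\alpha}$, $\|A\|_0=\sup_x|A(x)|$, $\|A\|_\alpha=\mathrm{Hold}_\alpha(A)+\|A\|_0$. $C^\alpha(\Sigma^+,\mathbb{R})$ is the space of $\alpha$-Hölder functions $A:\Sigma^+\to\mathbb{R}$ with norm $\|\cdot\|_\alpha$, and $C^\alpha_0(\Sigma^+,\mathbb{R})$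 is the subset of those $A$ with topological pressure $P(A)=\max_\nu\big(h(\nu)+\int A\,d\nu\big)=0$, where $\nu$ ranges over $\sigma$-invariant Borel probabilities and $h(\nu)$ is the metric entropy, with the induced topology. $C^{\alpha+}_0(\Sigma^+,\mathbb{R})$ is the closure, in the $\alpha$-Hölder topology, of $\bigcup_{\alpha<\gamma\le 1}C^\gamma_0(\Sigma^+,\mathbb{R})$ in $C^\alpha_0(\Sigma^+,\mathbb{R})$, with the $\alpha$-Hölder topology. A maximizing measure for $A$ is a $\sigma$-invariant Borel probability $\mu$ with $\int A\,d\mu=\max\{\int A\,d\nu:\nu\ \sigma\text{-invariant Borel probability}\}$. For a periodic point $p$ with $\sigma^n p=p$, $\nu_p$ is the $\sigma$-invariant probability $\nu_p=\frac1n\sum_{k=0}^{n-1}\delta_{\sigma^k p}$ supported on the orbit of $p$. *)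

(* Defs.v *)
From HB Require Import structures.
From mathcomp Require Import all_boot all_order all_algebra.
From mathcomp Require Import all_classical all_reals all_analysis.

Set Implicit Arguments.
Unset Strict Implicit.
Unset Printing Implicit Defensive.

Import Order.TTheory GRing.Theory Num.Theory.
Import numFieldNormedType.Exports.

Local Open Scope classical_set_scope.
Local Open Scope ring_scope.

Section Shift.
Context (R : realType) (k : nat) (M : 'M[bool]_k).

Definition admissible (x : nat -> 'I_k) : Prop := forall i, M (x i) (x i.+1).

(* The proofs ne and hlam are parameters of the type so that it can carry the
   point required by the measurable structure and the metric of ratio lam. *)
Definition sft (ne : exists x, admissible x) (lam : R) (hlam : 1 < lam)
  : Type :=
  {x : nat -> 'I_k | admissible x}.

Context (ne : exists x, admissible x) (lam : R) (hlam : 1 < lam).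
Local Notation X := (sft ne hlam).
Implicit Types x y z : X.

HB.instance Definition _ := gen_eqMixin X.
HB.instance Definition _ := gen_choiceMixin X.
HB.instance Definition _ := isPointed.Build X (exist _ _ (projT2 (cid ne))).

Definition sft_coord x : nat -> 'I_k := proj1_sig x.

Lemma sft_coord_inj x y : (forall i, sft_coord x i = sft_coord y i) -> x = y.
Proof. by move=> /funext xy; exact: eq_sig_hprop. Qed.

Definition sft_shift x : X :=
  exist admissible (fun i => sft_coord x i.+1) (fun i => proj2_sig x i.+1).

Definition sft_dist x y : R :=
  if pselect (exists i, sft_coord x i != sft_coord y i) is left h
  then lam ^- ex_minn h else 0.

Lemma sft_dist_le x y n :
  (forall i, (i < n)%N -> sft_coord x i = sft_coord y i) ->
  sft_dist x y <= lam ^- n.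
Proof.
move=> xy; have lam0 : 0 < lam by exact: lt_trans hlam.
rewrite /sft_dist; case: pselect => [h|_]; last first.
  by rewrite invr_ge0 exprn_ge0 ?ltW.
case: ex_minnP => m xym _; rewrite lef_pV2 ?posrE ?exprn_gt0//.
rewrite ler_eXn2l//; case: leqP => // mn.
by move: xym; rewrite xy ?eqxx.
Qed.

Lemma sft_dist_sym x y : sft_dist x y = sft_dist y x.
Proof.
rewrite /sft_dist; case: pselect => [h|h]; case: pselect => [h'|h'] //.
- congr (lam ^- _); case: ex_minnP => m hm lm; case: ex_minnP => m' hm' lm'.
  by apply/eqP; rewrite eqn_leq lm ?lm'// eq_sym.
- by exfalso; apply: h'; case: h => i; rewrite eq_sym; exists i.
- by exfalso; apply: h; case: h' => i; rewrite eq_sym; exists i.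
Qed.

Lemma sft_distxx x : sft_dist x x = 0.
Proof.
rewrite /sft_dist; case: pselect => // h; exfalso.
by case: h => i; rewrite eqxx.
Qed.

Lemma sft_dist_ge0 x y : 0 <= sft_dist x y.
Proof.
rewrite /sft_dist; case: pselect => // h.
by rewrite invr_ge0 exprn_ge0// ltW// (lt_trans _ hlam).
Qed.

Lemma sft_dist_positivity x y : sft_dist x y = 0 -> x = y.
Proof.
rewrite /sft_dist; case: pselect => [h /eqP|h _].
  by rewrite invr_eq0 expf_eq0 gt_eqF ?andbF// (lt_trans _ hlam).
apply: sft_coord_inj => i; apply/eqP/negPn/negP => xyi; apply: h; by exists i.
Qed.

Lemma sft_dist_triangle y x z : sft_dist x z <= sft_dist x y + sft_dist y z.
Proof.
rewrite {1}/sft_dist; case: pselect => [h|_]; last first.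
  by rewrite addr_ge0 ?sft_dist_ge0.
case: ex_minnP => m xzm mmin.
have lam0 : 0 < lam by exact: lt_trans hlam.
have [n nm [xyz|xyz]] : exists2 n, (n <= m)%N &
  sft_coord x n != sft_coord y n \/ sft_coord y n != sft_coord z n.
- exists m => //; case: (eqVneq (sft_coord x m) (sft_coord y m)) => [<-|].
    by right.
  by left.
- rewrite (@le_trans _ _ (sft_dist x y)) ?lerDl ?sft_dist_ge0//.
  rewrite /sft_dist; case: pselect => [h'|[]]; last by exists n.
  case: ex_minnP => j _ /(_ _ xyz) jn.
  by rewrite lef_pV2 ?posrE ?exprn_gt0// ler_eXn2l// (leq_trans jn).
- rewrite (@le_trans _ _ (sft_dist y z)) ?lerDr ?sft_dist_ge0//.
  rewrite /sft_dist; case: pselect => [h'|[]]; last by exists n.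
  case: ex_minnP => j _ /(_ _ xyz) jn.
  by rewrite lef_pV2 ?posrE ?exprn_gt0// ler_eXn2l// (leq_trans jn).
Qed.

HB.instance Definition _ := isMetric.Build R X sft_distxx sft_dist_positivity
  sft_dist_sym sft_dist_triangle.

HB.instance Definition _ := @isMeasurable.Build (sigma_display (@open X)) X
  <<s (@open X) >> (@sigma_algebra0 _ setT _) (@sigma_algebraC _ _)
  (@sigma_algebra_bigcup _ setT _).

End Shift.
Arguments sft_shift {R k M} ne {lam} hlam x.

Definition topologically_mixing (T : topologicalType) (f : T -> T) : Prop :=
  forall U V : set T, open U -> open V -> U !=set0 -> V !=set0 ->
  \forall n \near \oo, U `&` (iter n f @^-1` V) !=set0.

Section Ergodic.
Context d (T : measurableType d) (R : realType) (f : T -> T).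
Implicit Types (mu nu : probability T R) (A : T -> R).

Definition invariant_measure mu : Prop :=
  forall Y, measurable Y -> mu (f @^-1` Y) = mu Y.

Definition measurable_partition m (xi : 'I_m -> set T) : Prop :=
  [/\ forall i, measurable (xi i), trivIset setT xi &
      \bigcup_i xi i = setT].

(* The cells of the join of f^-i xi for i < n are indexed by words w of length
   n; empty cells contribute 0 to the entropy since ln 0 = 0. *)
Definition join_cell m (xi : 'I_m -> set T) n (w : {ffun 'I_n -> 'I_m}) :=
  [set x : T | forall i : 'I_n, xi (w i) (iter i f x)].

Definition join_entropy mu m (xi : 'I_m -> set T) n : R :=
  - \sum_(w : {ffun 'I_n -> 'I_m})
      fine (mu (join_cell xi w)) * ln (fine (mu (join_cell xi w))).

Definition partition_entropy mu m (xi : 'I_m -> set T) : R :=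
  limn (fun n => join_entropy mu xi n / n%:R).

Definition entropy mu : \bar R :=
  ereal_sup [set h | exists m (xi : 'I_m -> set T),
    measurable_partition xi /\ h = (partition_entropy mu xi)%:E].

(* The supremum is a maximum whenever mu |-> entropy mu is upper
   semicontinuous, as is the case for subshifts. *)
Definition pressure A : \bar R :=
  ereal_sup
    [set (entropy mu + \int[mu]_x (A x)%:E)%E | mu in invariant_measure].

Definition maximizing A mu : Prop :=
  invariant_measure mu /\
  forall nu, invariant_measure nu ->
    (\int[nu]_x (A x)%:E <= \int[mu]_x (A x)%:E)%E.

(* Measures are compared on measurable sets only: as set functions they take
   unspecified values elsewhere. *)
Definition uniquely_maximizing A mu : Prop :=
  maximizing A mu /\
  forall nu, maximizing A nu -> forall Y, measurable Y -> nu Y = mu Y.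

Definition orbit_measure (p : T) (n : nat) : set T -> \bar R :=
  mscale (n.+1%:R^-1)%:nng (msum (fun i => \d_(iter i f p)) n.+1).

HB.instance Definition _ p n := Measure.on (orbit_measure p n).

Lemma orbit_measureT p n : orbit_measure p n setT = 1%E.
Proof.
rewrite /orbit_measure /mscale /= /msum.
rewrite (eq_bigr (fun=> 1%E)) => [|i _]; last exact: diracT.
by rewrite sumEFin sumr_const card_ord -EFinM mulVf// pnatr_eq0.
Qed.

(* nu_p for a point p with f^(n+1) p = p *)
HB.instance Definition _ p n := @Measure_isProbability.Build _ T R
  (orbit_measure p n) (orbit_measureT p n).
Definition orbit_probability p n : probability T R := orbit_measure p n.

End Ergodic.

Section Sup.
Context (R : realType) (I : Type) (D : set I).
Implicit Types f g h : I -> R.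
Local Notation bnd f := (has_ubound [set f i | i in D]).
Local Notation S f := (sup [set f i | i in D]).

Lemma fsup_ge f i : bnd f -> D i -> f i <= S f.
Proof. by move=> bf Di; apply: ub_le_sup => //; exists i. Qed.

Lemma fsup_ge0 f : (forall i, 0 <= f i) -> bnd f -> 0 <= S f.
Proof.
move=> f0 bf; have [[i Di]|/nonemptyPn D0] := pselect (D !=set0).
  by rewrite (le_trans (f0 i))// fsup_ge.
by rewrite D0 image_set0 sup0.
Qed.

Lemma fsup_le f c : 0 <= c -> (forall i, D i -> f i <= c) -> S f <= c.
Proof.
move=> c0 fc; have [[i Di]|/nonemptyPn D0] := pselect (D !=set0).
  by apply: ge_sup; [exists (f i), i|move=> _ [j Dj <-]; exact: fc].
by rewrite D0 image_set0 sup0.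
Qed.

End Sup.

Section Holder.
Context (R : realType) (X : metricType R).
Implicit Types (a : R) (A B : X -> R).

Definition holder_pairs : set (X * X) := [set u | 0 < mdist u.1 u.2 <= 1].

Definition holder_quotient a A (u : X * X) : R :=
  `|A u.1 - A u.2| / mdist u.1 u.2 `^ a.

Definition is_holder a A : Prop :=
  has_ubound [set holder_quotient a A u | u in holder_pairs].

(* sup set0 = 0: the seminorm vanishes when X is a single point. *)
Definition Hold a A : R := sup [set holder_quotient a A u | u in holder_pairs].

Definition supnorm A : R := sup [set `|A x| | x in setT].

Definition holder_norm a A : R := Hold a A + supnorm A.

Lemma holder_quotient_ge0 a A u : 0 <= holder_quotient a A u.
Proof. by rewrite divr_ge0 ?powR_ge0. Qed.

Lemma holder_quotientD a A B c u :
  holder_quotient a (fun x => c * A x + B x) u <=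
  `|c| * holder_quotient a A u + holder_quotient a B u.
Proof.
rewrite /holder_quotient mulrA -mulrDl ler_wpM2r ?invr_ge0 ?powR_ge0//.
by rewrite -normrM opprD addrACA -mulrBr ler_normD.
Qed.

Lemma is_holder_lin a A B c :
  is_holder a A -> is_holder a B -> is_holder a (fun x => c * A x + B x).
Proof.
move=> hA hB; exists (`|c| * Hold a A + Hold a B) => _ [u Du <-].
rewrite (le_trans (holder_quotientD _ _ _ _ _))// lerD ?fsup_ge//.
by rewrite ler_wpM2l// fsup_ge.
Qed.

Lemma Hold_lin a A B c : is_holder a A -> is_holder a B ->
  Hold a (fun x => c * A x + B x) <= `|c| * Hold a A + Hold a B.
Proof.
move=> hA hB; apply: fsup_le => [|u Du].
  by rewrite addr_ge0 ?mulr_ge0// fsup_ge0// => u; exact: holder_quotient_ge0.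
rewrite (le_trans (holder_quotientD _ _ _ _ _))// lerD ?fsup_ge//.
by rewrite ler_wpM2l// fsup_ge.
Qed.

Lemma is_holder0 a : is_holder a (fun=> 0).
Proof.
by exists 0 => _ [u _ <-]; rewrite /holder_quotient subrr normr0 mul0r.
Qed.

Lemma Hold0 a : Hold a (fun=> 0) = 0.
Proof.
apply/eqP; rewrite eq_le fsup_ge0 ?andbT.
- by apply: fsup_le => // u _; rewrite /holder_quotient subrr normr0 mul0r.
- by move=> u; exact: holder_quotient_ge0.
- exact: is_holder0.
Qed.

End Holder.

Section HolderSpace.
Context (R : realType) (k : nat) (M : 'M[bool]_k).
Context (ne : exists x, admissible M x) (lam : R) (hlam : 1 < lam).
Local Notation X := (sft ne hlam).
Context (alpha : R) (ha : 0 < alpha).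
Implicit Types A B : X -> R.

Lemma mdist_sft_le1 (x y : X) : mdist x y <= 1.
Proof.
by have := @sft_dist_le _ _ _ ne _ hlam x y 0; rewrite expr0 invr1; exact.
Qed.

Lemma is_holder_bounded A : is_holder alpha A ->
  has_ubound [set `|A x| | x in setT].
Proof.
move=> hA; exists (`|A point| + Hold alpha A) => _ [x _ <-].
rewrite -lerBlDl (le_trans (lerB_dist _ _))//.
have [->|/eqP xp] := eqVneq x point.
  rewrite subrr normr0 fsup_ge0// => u; exact: holder_quotient_ge0.
have d0 : 0 < mdist x point.
  by rewrite lt_def mdist_ge0 andbT; apply/eqP => /mdist_positivity.
have := @fsup_ge R _ (@holder_pairs R X) (holder_quotient alpha A)
  (x, point) hA.
rewrite /holder_pairs/= d0 mdist_sft_le1 => /(_ isT).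
rewrite /holder_quotient/= ler_pdivrMr ?powR_gt0// => /le_trans; apply.
rewrite ler_piMr//.
  by rewrite fsup_ge0// => u; exact: holder_quotient_ge0.
rewrite (_ : 1 = 1 `^ alpha); last by rewrite powR1.
by rewrite ge0_ler_powR ?nnegrE ?mdist_ge0 ?mdist_sft_le1 ?ltW.

Qed.
Definition holder_pred : {pred X -> R^o} :=
  [pred A : X -> R^o | `[< is_holder alpha A >] ].

(* The space C^alpha(X, R); ha is a parameter of the type because boundedness
   of Holder functions is needed for holder_norm to be a norm. *)
Record holder (alpha_gt0 : 0 < alpha) := Holder {
  holder_fun :> X -> R^o;
  holder_funP : holder_fun \in holder_pred }.
Local Notation C := (holder ha).

HB.instance Definition _ := [isSub for @holder_fun ha].
HB.instance Definition _ := gen_eqMixin C.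
HB.instance Definition _ := [Choice of C by <:].

Lemma holder_submod_closed : submod_closed holder_pred.
Proof.
split; first by rewrite inE; exact: is_holder0.
move=> c A B; rewrite !inE; exact: is_holder_lin.
Qed.

HB.instance Definition _ :=
  GRing.isSubmodClosed.Build _ _ holder_pred holder_submod_closed.
HB.instance Definition _ := [SubChoice_isSubLmodule of C by <:].

Implicit Types F G : C.

Lemma holderP F : is_holder alpha F.
Proof. by have := holder_funP F; rewrite inE. Qed.

Lemma supnorm_holder_le F c :
  0 <= c -> (forall x, `|F x| <= c) -> supnorm F <= c.
Proof.
move=> c0 Fc.
by apply: (@fsup_le R X setT (fun x => `|F x : R|)) => // x _; exact: Fc.
Qed.

Lemma holder_le_supnorm F x : `|F x| <= supnorm F.
Proof.
exact: (@fsup_ge R X setT (fun x => `|F x : R|) x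
  (is_holder_bounded (holderP F)) I).
Qed.

Lemma supnorm_ge0 F : 0 <= supnorm F.
Proof.
apply: (@fsup_ge0 R X setT (fun x => `|F x : R|)) => //.
exact: is_holder_bounded (holderP F).
Qed.

Lemma Hold_ge0 F : 0 <= Hold alpha F.
Proof. by apply: fsup_ge0 (holderP F) => u; exact: holder_quotient_ge0. Qed.

Lemma holder_norm_lin F G c :
  holder_norm alpha (c *: F + G) <=
  `|c| * holder_norm alpha F + holder_norm alpha G.
Proof.
rewrite /holder_norm mulrDr addrACA lerD//.
  exact: Hold_lin (holderP F) (holderP G).
apply: supnorm_holder_le => [|x].
  by rewrite addr_ge0 ?mulr_ge0 ?supnorm_ge0.
rewrite (le_trans (ler_normD _ _))// lerD ?holder_le_supnorm//.
by rewrite normrM ler_wpM2l// holder_le_supnorm.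
Qed.

Lemma holder_norm0 : holder_norm alpha (0 : C) = 0.
Proof.
rewrite /holder_norm [X in X + _](Hold0 X alpha) add0r; apply/eqP.
rewrite eq_le supnorm_ge0 andbT; apply: supnorm_holder_le => // x.
by rewrite normr0.
Qed.

Lemma ler_holder_normD F G :
  holder_norm alpha (F + G) <= holder_norm alpha F + holder_norm alpha G.
Proof. by have := holder_norm_lin F G 1; rewrite scale1r normr1 mul1r. Qed.

Lemma holder_normZ c F :
  holder_norm alpha (c *: F) = `|c| * holder_norm alpha F.
Proof.
have le a (H : C) : holder_norm alpha (a *: H) <= `|a| * holder_norm alpha H.
  by have := holder_norm_lin H 0 a; rewrite addr0 holder_norm0 addr0.
have [->|c0] := eqVneq c 0; first by rewrite scale0r holder_norm0 normr0 mul0r.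
apply/eqP; rewrite eq_le le/=.
have := le c^-1 (c *: F); rewrite scalerA mulVf// scale1r normfV.
by rewrite ler_pdivlMl ?normr_gt0.
Qed.

Lemma holder_norm0_eq0 F : holder_norm alpha F = 0 -> F = 0.
Proof.
move/eqP; rewrite paddr_eq0 ?Hold_ge0 ?supnorm_ge0// => /andP[_ /eqP F0].
apply/val_inj/funext => x; apply/eqP; rewrite -normr_le0 -F0.
exact: holder_le_supnorm.
Qed.

HB.instance Definition _ := Lmodule_isNormed.Build R C
  ler_holder_normD holder_normZ holder_norm0_eq0.

Local Notation sigma := (sft_shift ne hlam).

Definition holder0 : set C :=
  [set A : C | pressure sigma A = 0%E].

(* C^gamma_0 seen inside C^alpha, for alpha < gamma *)
Definition holder0_exp (gamma : R) : set C :=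
  [set A : C | is_holder gamma A /\ holder0 A].

(* The closure relative to C^alpha_0. *)
Definition holder0_plus : set C :=
  holder0 `&` closure (\bigcup_(gamma in `]alpha, 1]) holder0_exp gamma).

(* Coercing the set to a type gives it the topology induced by C^alpha. *)
Definition G2 : set (set_type holder0_plus) :=
  [set A : set_type holder0_plus | exists (p : X) (n : nat),
    iter n.+1 sigma p = p /\
    \forall B \near A, uniquely_maximizing sigma
      (set_val B : C) (orbit_probability R sigma p n)].

End HolderSpace.
Arguments holder0_plus {R k M} ne {lam} hlam {alpha} ha.
Arguments G2 {R k M} ne {lam} hlam {alpha} ha.

(* Main.v *)
Require Import Defs.
From HB Require Import structures.
From mathcomp Require Import all_boot all_order all_algebra.
From mathcomp Require Import all_classical all_reals all_analysis.
From mathcomp Require Import measurable_realfun.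
From mathcomp Require Import ring lra zify.

Set Implicit Arguments.
Unset Strict Implicit.
Unset Printing Implicit Defensive.

Import Order.TTheory GRing.Theory Num.Theory.
Import numFieldNormedType.Exports.

Local Open Scope classical_set_scope.
Local Open Scope ring_scope.

(** Openness is immediate, since the defining property of the set is itself
    required on a neighbourhood. Density rests on the gap between the exponent
    alpha of the topology and the exponent gamma > alpha of the potentials that
    are dense by construction.

    Let A be gamma-Holder. Write m for the supremum of the averages of A along
    periodic orbits. Every orbit segment can be closed up into a periodic orbit
    at a bounded cost, so the Birkhoff sums of A - m are bounded above, and the
    supremum u of these sums over backward orbits is a gamma-Holder
    sub-action: G = m - A + u o sigma - u is nonnegative and gamma-Holder, and
    has periodic orbits of arbitrarily small average
    ([normalized_potential]). Following such an orbit long enough and cutting it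
    at a return of minimal length to a cylinder of length N gives a periodic
    orbit O whose points are separated by their first N symbols and along which
    the total of G is at most a constant times lam^(- gamma N)
    ([short_light_orbit]).

    Now charge a price of order c, a small multiple of lam^(- alpha N), for each
    visit outside the (N+1)-cylinders around O. This perturbs A little in the
    alpha-Holder norm, yet c is much larger than lam^(- gamma N). An orbit that
    stays in these cylinders shadows O and can do better than the average over
    O only by the distortion of G along the shadowing plus the total of G over
    an incomplete period, both O(lam^(- gamma N)). The price paid at the next
    exit exceeds this gain ([excursion_bound]), and the same comparison still
    holds after adding any f with small alpha-Holder seminorm, because
    distortion estimates survive with exponent alpha. Hence all potentials F
    close to the perturbed one satisfy, up to a bounded error, that the Birkhoff
    sum of F plus c times the number of visits outside the cylinders is at most
    the number of steps times the average over O ([locking_gap]).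

    Integrating this inequality shows that the measure on O is maximizing, and
    that every maximizing measure gives no mass to the complement of the
    cylinders; it is then carried by the points that never leave them, which
    are those of O ([gap_uniquely_maximizing]). Finally the pressure of the
    perturbed potential lies within 2 c of zero, so subtracting it restores zero
    pressure without leaving the neighbourhood ([normalized_perturbation]). *)

(** * Birkhoff sums *)

Section Birkhoff.
Context (T : Type) (R : realType) (f : T -> T).
Implicit Types (A B u : T -> R) (x p : T).

Definition birkhoff A n x : R := \sum_(i < n) A (iter i f x).

Lemma birkhoff0 A x : birkhoff A 0 x = 0.
Proof. exact: big_ord0. Qed.

Lemma birkhoffSr A n x : birkhoff A n.+1 x = birkhoff A n x + A (iter n f x).
Proof. exact: big_ord_recr. Qed.

Lemma birkhoffS A n x : birkhoff A n.+1 x = A x + birkhoff A n (f x).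
Proof.
rewrite /birkhoff big_ord_recl; congr (_ + _).
by apply: eq_bigr => i _; rewrite -iterSr.
Qed.

Lemma birkhoff_cat A m n x :
  birkhoff A (m + n) x = birkhoff A m x + birkhoff A n (iter m f x).
Proof.
elim: m x => [|m IH] x; first by rewrite birkhoff0 add0r.
by rewrite addSn !birkhoffS IH addrA -iterSr.
Qed.

Lemma birkhoffD A B n x :
  birkhoff (fun y => A y + B y) n x = birkhoff A n x + birkhoff B n x.
Proof. exact: big_split. Qed.

Lemma birkhoffN A n x : birkhoff (fun y => - A y) n x = - birkhoff A n x.
Proof. exact: sumrN. Qed.

Lemma birkhoffB A B n x :
  birkhoff (fun y => A y - B y) n x = birkhoff A n x - birkhoff B n x.
Proof. by rewrite birkhoffD birkhoffN. Qed.

Lemma birkhoffZ A c n x :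
  birkhoff (fun y => c * A y) n x = c * birkhoff A n x.
Proof. by rewrite /birkhoff mulr_sumr. Qed.

Lemma birkhoff_cst c n x : birkhoff (fun=> c) n x = c * n%:R.
Proof. by rewrite /birkhoff sumr_const card_ord mulr_natr. Qed.

Lemma birkhoff_coboundary u n x :
  birkhoff (fun y => u (f y) - u y) n x = u (iter n f x) - u x.
Proof.
elim: n => [|n IH]; first by rewrite birkhoff0 subrr.
by rewrite birkhoffSr IH iterS; ring.
Qed.

Lemma ler_birkhoff A B n x :
  (forall y, A y <= B y) -> birkhoff A n x <= birkhoff B n x.
Proof. by move=> AB; apply: ler_sum => i _; exact: AB. Qed.

Lemma birkhoff_ge0 A n x : (forall y, 0 <= A y) -> 0 <= birkhoff A n x.
Proof. by move=> A0; apply: sumr_ge0. Qed.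

Lemma ler_birkhoff_len A m n x : (forall y, 0 <= A y) -> (m <= n)%N ->
  birkhoff A m x <= birkhoff A n x.
Proof.
by move=> A0 /subnKC <-; rewrite birkhoff_cat lerDl birkhoff_ge0.
Qed.

Lemma iter_periodic n p : iter n f p = p ->
  forall i, iter n f (iter i f p) = iter i f p.
Proof. by move=> np i; rewrite -iterD addnC iterD np. Qed.

Lemma iter_mul_periodic n p : iter n f p = p ->
  forall j, iter (j * n) f p = p.
Proof. by move=> np; elim=> // j IH; rewrite mulSn iterD IH. Qed.

Lemma birkhoff_periodic A n p : iter n f p = p ->
  forall i, birkhoff A n (iter i f p) = birkhoff A n p.
Proof.
move=> np; elim=> // i <-.
apply: (@addrI _ (A (iter i f p))); rewrite iterS -birkhoffS.
by rewrite birkhoffSr addrC iter_periodic.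
Qed.

End Birkhoff.

(** * Cylinders, Holder regularity and distortion *)

Section Symbolic.
Context (R : realType) (k : nat) (M : 'M[bool]_k).
Context (ne : exists x, admissible M x) (lam : R) (hlam : 1 < lam).
Local Notation X := (sft ne hlam).
Local Notation sigma := (sft_shift ne hlam).
Implicit Types (x y p q : X) (A G u : X -> R) (th C : R).

Definition agree n x y :=
  forall i, (i < n)%N -> sft_coord x i = sft_coord y i.

Lemma coord_iter j x i : sft_coord (iter j sigma x) i = sft_coord x (j + i).
Proof. by elim: j i => // j IH i; rewrite iterS /= IH addSnnS. Qed.

Lemma agree_refl n x : agree n x x. Proof. by []. Qed.

Lemma agreeC n x y : agree n x y -> agree n y x.
Proof. by move=> xy i /xy. Qed.

Lemma agree_trans n x y z : agree n x y -> agree n y z -> agree n x z.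
Proof. by move=> xy yz i im; rewrite xy// yz. Qed.

Lemma agree_le n m x y : (m <= n)%N -> agree n x y -> agree m x y.
Proof. by move=> mn xy i im; apply: xy; exact: leq_trans mn. Qed.

Lemma agree_iter j n x y :
  agree (j + n) x y -> agree n (iter j sigma x) (iter j sigma y).
Proof. by move=> xy i ni; rewrite !coord_iter xy// ltn_add2l. Qed.

Lemma agree_shift n x y : agree n.+1 x y -> agree n (sigma x) (sigma y).
Proof. exact: (@agree_iter 1). Qed.

Lemma agreeS n x y : agree 1 x y -> agree n (sigma x) (sigma y) ->
  agree n.+1 x y.
Proof. by move=> xy sxy [|i]; [move=> _; apply: xy|exact: sxy]. Qed.

Lemma agree_eq x y : (forall n, agree n x y) -> x = y.
Proof. by move=> xy; apply: sft_coord_inj => i; apply: (xy i.+1). Qed.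

(** For th = lam^(- a) this is a-Holder continuity with constant C, stated on
    cylinders so that the dynamical estimates involve natural powers only. *)
Definition cyl_holder th C A :=
  forall n x y, agree n x y -> `|A x - A y| <= C * th ^+ n.

(** The sum of the powers th^i over i >= 1. *)
Definition geom_tail th := th / (1 - th).

Lemma sum_geom_tail th n : th < 1 ->
  \sum_(i < n) th ^+ (n - i) = geom_tail th * (1 - th ^+ n).
Proof.
move=> th1; have th1' : 1 - th != 0 by rewrite subr_eq0 eq_sym lt_eqF.
elim: n => [|n IH]; first by rewrite big_ord0 expr0 subrr mulr0.
rewrite big_ord_recl subn0 (eq_bigr (fun i : 'I_n => th ^+ (n - i))) ?IH//.
by rewrite /geom_tail exprS; field.
Qed.

Lemma geom_tail_ge0 th : 0 < th -> th < 1 -> 0 <= geom_tail th.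
Proof. by move=> th0 th1; rewrite /geom_tail divr_ge0 ?subr_ge0 ?ltW. Qed.

Lemma cyl_holder_const_ge0 th C A : cyl_holder th C A -> 0 <= C.
Proof.
by move=> /(_ 0%N point point (@agree_refl _ _)); rewrite subrr normr0 mulr1.
Qed.

Lemma cyl_holder_osc th C A x y : cyl_holder th C A -> `|A x - A y| <= C.
Proof. by move=> /(_ 0%N x y); rewrite expr0 mulr1; apply. Qed.

(** At time i the two orbits still share n - i + N symbols, so the differences
    form a geometric series dominated by its last term: the bound does not
    depend on n. *)
Lemma birkhoff_distortion th C A n N x y : 0 < th -> th < 1 ->
  cyl_holder th C A -> agree (n + N) x y ->
  `|birkhoff sigma A n x - birkhoff sigma A n y|
    <= C * geom_tail th * th ^+ N.
Proof.
move=> th0 th1 hA xy; have C0 := cyl_holder_const_ge0 hA.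
rewrite /birkhoff -sumrB (le_trans (ler_norm_sum _ _ _))//.
have le i : (i < n)%N ->
    `|A (iter i sigma x) - A (iter i sigma y)| <= C * th ^+ N * th ^+ (n - i).
  move=> ni; rewrite -mulrA -exprD; apply: hA; apply: agree_iter.
  apply: agree_le xy; lia.
rewrite (le_trans (ler_sum _ (fun (i : 'I_n) _ => le i (ltn_ord i))))//.
rewrite -mulr_sumr sum_geom_tail// [leRHS]mulrAC.
rewrite ler_wpM2l ?mulr_ge0 ?exprn_ge0 ?(ltW th0)//.
by rewrite ler_piMr ?geom_tail_ge0// gerBl exprn_ge0// ltW.
Qed.

End Symbolic.

(** * Closing orbit segments *)

Section Closing.
Context (R : realType) (k : nat) (M : 'M[bool]_k).
Context (ne : exists x, admissible M x) (lam : R) (hlam : 1 < lam).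
Local Notation X := (sft ne hlam).
Local Notation sigma := (sft_shift ne hlam).
Implicit Types (x y z p q : X).

Lemma coord_allowed x i : M (sft_coord x i) (sft_coord x i.+1).
Proof. exact: (proj2_sig x). Qed.

Lemma mdist_lt_agree n x y : mdist x y < lam ^- n -> agree n.+1 x y.
Proof.
have lam0 : 0 < lam by exact: lt_trans hlam.
rewrite /mdist/= /sft_dist; case: pselect => [h|h _]; last first.
  by move=> i _; apply/eqP/negPn/negP => xyi; apply: h; exists i.
case: ex_minnP => m _ minm.
rewrite ltf_pV2 ?posrE ?exprn_gt0// ltr_eXn2l// => nm i ni.
apply/eqP/negPn/negP => /minm mi.
by move: (leq_trans mi ni); rewrite leqNgt nm.
Qed.

Lemma agree_open (U : set X) :
  (forall x, U x -> exists n, forall y, agree n x y -> U y) -> open U.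
Proof.
move=> hU; rewrite openE => x /hU[n nU]; apply/nbhs_ballP.
have lam0 : 0 < lam by exact: lt_trans hlam.
exists (lam ^- n) => /=; first by rewrite invr_gt0 exprn_gt0.
by rewrite ballEmdist => y /= /mdist_lt_agree xy; apply/nU/(agree_le _ xy).
Qed.

(** The alphabet is finite, hence the bound L is uniform. *)
Lemma mixing_bridge : topologically_mixing sigma ->
  exists L, forall x y, exists l z, [/\ (0 < l <= L)%N,
    sft_coord z 0 = sft_coord x 0 & sft_coord z l = sft_coord y 0].
Proof.
move=> mix.
have /choice[f hf] (ab : 'I_k * 'I_k) : exists l, forall x y,
    sft_coord x 0 = ab.1 -> sft_coord y 0 = ab.2 ->
    exists z, [/\ (0 < l)%N, sft_coord z 0 = ab.1 & sft_coord z l = ab.2].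
  have cyl_open a : open [set z : X | sft_coord z 0 = a].
    by apply: agree_open => x <-; exists 1%N => y /(_ 0%N isT).
  have [[x [y [xa yb]]]|no] := pselect (exists x y : X,
      sft_coord x 0 = ab.1 /\ sft_coord y 0 = ab.2); last first.
    by exists 0%N => x y xa yb; exfalso; apply: no; exists x, y.
  have [||N _ /(_ N.+1 (leqnSn N)) [z [za zb]]] :=
      mix _ _ (cyl_open ab.1) (cyl_open ab.2).
  - by exists x.
  - by exists y.
  exists N.+1 => _ _ _ _; exists z; split=> //.
  by rewrite -[N.+1]addn0 -coord_iter; exact: zb.
exists (\max_ab f ab)%N => x y.
have [z [l0 z0 zl]] := hf (sft_coord x 0, sft_coord y 0) x y erefl erefl.
by exists (f (sft_coord x 0, sft_coord y 0)), z; rewrite l0 leq_bigmax.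
Qed.

Lemma periodic_word (w : nat -> 'I_k) n : (0 < n)%N ->
  (forall i, (i < n)%N -> M (w i) (w i.+1)) -> w n = w 0%N ->
  exists p, iter n sigma p = p /\
    forall i, (i < n)%N -> sft_coord p i = w i.
Proof.
move=> n0 adm wn.
have adm' : admissible M (fun i => w (i %% n)%N).
  move=> i; have := adm _ (ltn_pmod i n0).
  rewrite -[in X in _ -> is_true (M _ (w X))]addn1 -modnDml addn1.
  have := ltn_pmod i n0; rewrite leq_eqVlt => /orP[/eqP ->|lt].
    by rewrite wn modnn.
  by rewrite (modn_small lt).
exists (exist _ _ adm' : X); split.
  by apply: sft_coord_inj => i; rewrite coord_iter/= modnDl.
by move=> i ni /=; rewrite modn_small.
Qed.

(** The periodic point repeats the first n symbols of x; the agreement extends N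
    symbols beyond because x itself repeats its first N symbols at time n. *)
Lemma close_return x n N : (0 < n)%N -> (0 < N)%N ->
  agree N x (iter n sigma x) ->
  exists p, iter n sigma p = p /\ agree (n + N) p x.
Proof.
move=> n0 N0 ret.
have [|p [np px]] := @periodic_word (sft_coord x) n n0
    (fun i _ => coord_allowed x i).
  by rewrite (ret 0%N N0) coord_iter addn0.
exists p; split=> // i; elim/ltn_ind: i => i IH inN.
have [|ni] := ltnP i n; first exact: px.
have ini : (i - n < i)%N by lia.
rewrite -{1}(subnKC ni) -coord_iter np IH//; last lia.
by rewrite ret ?coord_iter ?subnKC//; lia.
Qed.

(** The weak specification property that mixing provides. *)
Definition closable L := forall n y, exists l q,
  [/\ (0 < l <= L)%N, iter (n + l) sigma q = q & agree n q y].

Lemma mixing_closable : topologically_mixing sigma -> exists L, closable L.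
Proof.
move=> /mixing_bridge[L hL]; exists L => n y.
have [l [z [/andP[l0 lL] z0 zl]]] := hL (iter n sigma y) y.
rewrite coord_iter addn0 in z0.
pose w i := if (i <= n)%N then sft_coord y i else sft_coord z (i - n).
have [| | |q [qn qw]] := @periodic_word w (n + l).
- by rewrite addn_gt0 l0 orbT.
- rewrite /w => i; case: (ltngtP i n) => [_ _|ni _|-> _].
  + exact: coord_allowed.
  + by rewrite (subSn (ltnW ni)); exact: coord_allowed.
  + rewrite -z0 subSnn; exact: (coord_allowed z 0).
- by rewrite /w leq0n addnC addnK -{2}(add0n n) leq_add2r leqNgt l0.
exists l, q; split=> //; first by rewrite l0.
by move=> i ni; rewrite qw ?/w ?(ltnW ni)//; exact: ltn_addr.
Qed.

(** The inverse branches of sigma^j over points sharing a cylinder match up. *)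
Lemma branch_preimage x x' n j y : (0 < n)%N -> agree n x x' ->
  iter j sigma y = x ->
  exists y', iter j sigma y' = x' /\ agree (j + n) y y'.
Proof.
move=> n0 xx' yx.
pose w i := if (i < j)%N then sft_coord y i else sft_coord x' (i - j).
have adm : admissible M w.
  move=> i; rewrite /w; case: (ltngtP i.+1 j) => [ij|ij|ij].
  - exact: coord_allowed.
  - by rewrite subSn//; exact: coord_allowed.
  - rewrite -ij subnn -(xx' _ n0) -yx coord_iter addn0 -ij.
    exact: coord_allowed.
exists (exist _ w adm : X); split.
  apply: sft_coord_inj => i; rewrite coord_iter/= /w.
  by rewrite ltnNge leq_addr/= addKn.
move=> i ijn /=; rewrite /w; case: ltnP => // ji.
by rewrite -xx' -?yx ?coord_iter ?subnKC//; lia.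
Qed.

End Closing.

(** * Sub-actions and light periodic orbits *)

Section SubAction.
Context (R : realType) (k : nat) (M : 'M[bool]_k).
Context (ne : exists x, admissible M x) (lam : R) (hlam : 1 < lam).
Local Notation X := (sft ne hlam).
Local Notation sigma := (sft_shift ne hlam).
Local Notation S := (birkhoff sigma).
Implicit Types (x y z p q : X) (A G u : X -> R).
Context (th : R) (th0 : 0 < th) (th1 : th < 1).

(** The sub-action u x is the supremum of the Birkhoff sums of A over all
    backward orbits of x. Prolonging a backward orbit of x by x itself gives
    the cohomological inequality, and distortion along matching inverse
    branches gives the regularity. *)
Lemma bounded_birkhoff_sub_action A C K : cyl_holder th C A ->
  (forall n y, S A n y <= K) ->
  exists u Cu, cyl_holder th Cu u /\ forall x, A x <= u (sigma x) - u x.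
Proof.
move=> hA bK; have C0 := cyl_holder_const_ge0 hA.
pose P x := [set s | exists n y, iter n sigma y = x /\ s = S A n y].
pose u x := sup (P x).
have P0 x : P x 0 by exists 0%N, x; rewrite birkhoff0.
have Pub x : ubound (P x) K by move=> _ [n [y [_ ->]]].
have uge x s : P x s -> s <= u x by move=> ?; apply: ub_le_sup => //; exists K.
have ule x c : ubound (P x) c -> u x <= c by apply: ge_sup; exists 0.
have K0 : 0 <= K by exact: (Pub point).
have t0 : 0 <= C * geom_tail th by rewrite mulr_ge0 ?geom_tail_ge0.
exists u, (K + C * geom_tail th); split; last first.
  move=> x; rewrite lerBrDr -lerBrDl; apply: ule => _ [n [y [nx ->]]].
  rewrite lerBrDl addrC; apply: uge; exists n.+1, y.
  by rewrite iterS nx birkhoffSr nx.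
have half n x x' : (0 < n)%N -> agree n x x' ->
    u x <= u x' + C * geom_tail th * th ^+ n.
  move=> n0 xx'; apply: ule => _ [j [y [jx ->]]].
  have [y' [jx' yy']] := branch_preimage n0 xx' jx.
  have := birkhoff_distortion th0 th1 hA yy'.
  rewrite ler_norml => /andP[_]; rewrite lerBlDl => /le_trans; apply.
  by rewrite lerD2r; apply: uge; exists j, y'.
move=> [|n] x x' xx'.
  rewrite expr0 mulr1; apply: (@le_trans _ _ K); last by rewrite lerDl.
  have := (uge x 0 (P0 x), uge x' 0 (P0 x'), ule x K (Pub x), ule x' K (Pub x')).
  by move=> [[[? ?] ?] ?]; rewrite ler_norml; lra.
apply: (@le_trans _ _ (C * geom_tail th * th ^+ n.+1)); last first.
  by rewrite ler_wpM2r ?lerDr// exprn_ge0// ltW.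
have := (half n.+1 x x' isT xx', half n.+1 x' x isT (agreeC xx')).
by move=> [? ?]; rewrite ler_norml; lra.
Qed.

Definition orbit_averages A : set R := [set a | exists n q,
  [/\ (0 < n)%N, iter n sigma q = q & a * n%:R = S A n q]].

Definition max_average A := sup (orbit_averages A).

Context (L : nat) (hL : closable ne hlam L).

Lemma max_averageP A C : cyl_holder th C A ->
  [/\ forall n q, (0 < n)%N -> iter n sigma q = q ->
        S A n q <= max_average A * n%:R,
      forall x, max_average A <= A x + C &
      forall e, 0 < e -> exists n q, [/\ (0 < n)%N, iter n sigma q = q &
        (max_average A - e) * n%:R <= S A n q]].
Proof.
move=> hA.
have ub x : ubound (orbit_averages A) (A x + C).
  move=> a [n [q [n0 nq an]]].
  rewrite -(ler_pM2r (_ : 0 < n%:R)) ?ltr0n// an -(birkhoff_cst sigma _ n q).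
  apply: ler_birkhoff => y; rewrite -lerBlDl.
  by apply: le_trans (cyl_holder_osc y x hA); rewrite ler_norm.
have ex n q : (0 < n)%N -> iter n sigma q = q ->
    orbit_averages A (S A n q / n%:R).
  by move=> n0 nq; exists n, q; split=> //; rewrite divfK// pnatr_eq0 -lt0n.
have hs : has_sup (orbit_averages A).
  split; last by exists (A point + C); exact: ub.
  have [l [q [/andP[l0 _] lq _]]] := hL 0 point.
  by exists (S A l q / l%:R); apply: ex.
split.
- move=> n q n0 nq; rewrite -ler_pdivrMr ?ltr0n//.
  by apply: ub_le_sup; [exact: hs.2|exact: ex].
- by move=> x; apply: ge_sup (ub x); exact: hs.1.
- move=> e e0; have [a [n [q [n0 nq an]]] ae] := sup_adherent e0 hs.
  exists n, q; split=> //; rewrite -an ler_wpM2r ?ler0n//.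
  exact: ltW.
Qed.

(** Up to the constant m and a coboundary, -A is a nonnegative function G of the
    same regularity whose averages along periodic orbits have infimum 0. The
    Birkhoff sums of A - m are bounded above because closing a segment changes
    them by a bounded amount, while on a periodic orbit they are at most 0. *)
Theorem normalized_potential A C : cyl_holder th C A ->
  exists m u G CG, [/\ forall x, G x = m - A x + (u (sigma x) - u x),
    exists b, forall x, `|u x| <= b, cyl_holder th CG G, forall x, 0 <= G x &
    forall e, 0 < e -> exists n p, [/\ (0 < n)%N, iter n sigma p = p &
      S G n p <= e * n%:R]].
Proof.
move=> hA; have C0 := cyl_holder_const_ge0 hA.
have [mub mle madh] := max_averageP hA; set m := max_average A in mub mle madh.
pose A' x := A x - m.
have hA' : cyl_holder th C A'.
  by move=> n x y xy; rewrite /A' opprB addrA subrK; exact: hA.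
have A'ge x : - C <= A' x by have := mle x; rewrite /A'; lra.
have [|u [Cu [hu uA]]] :=
    @bounded_birkhoff_sub_action A' C (C * L%:R + C * geom_tail th) hA'.
  move=> n y; have [l [q [/andP[l0 lL] nlq qy]]] := hL n y.
  have yq : agree (n + 0) y q by rewrite addn0; exact: agreeC.
  have := birkhoff_distortion th0 th1 hA' yq => {yq}.
  rewrite expr0 mulr1 ler_norml => /andP[_ yq].
  have : S A' (n + l) q <= 0.
    by rewrite birkhoffB birkhoff_cst subr_le0 mub// ltn_addl.
  rewrite birkhoff_cat => q0.
  have : - C * l%:R <= S A' l (iter n sigma q).
    by rewrite -(birkhoff_cst sigma _ _ (iter n sigma q)) ler_birkhoff.
  have : C * l%:R <= C * L%:R by rewrite ler_wpM2l// ler_nat.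
  move: q0 yq; rewrite -/A'; lra.
have Cu0 := cyl_holder_const_ge0 hu.
pose G x := m - A x + (u (sigma x) - u x).
exists m, u, G, (C + Cu / th + Cu); split=> //.
- exists (`|u point| + Cu) => x.
  rewrite -lerBlDl (le_trans (lerB_dist _ _))//.
  exact: cyl_holder_osc hu.
- move=> n x y xy.
  have us : `|u (sigma x) - u (sigma y)| <= Cu / th * th ^+ n.
    case: n xy => [|n] xy.
      rewrite expr0 mulr1.
      apply: le_trans (cyl_holder_osc (sigma x) (sigma y) hu) _.
      by rewrite ler_peMr// invf_ge1// ltW.
    rewrite exprS mulrA divfK ?gt_eqF//; exact/hu/agree_shift.
  rewrite (_ : G x - G y = - (A x - A y) + (u (sigma x) - u (sigma y))
    - (u x - u y)); last by rewrite /G; ring.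
  rewrite (le_trans (ler_normB _ _))// [leRHS]mulrDl lerD ?hu//.
  rewrite (le_trans (ler_normD _ _))// [leRHS]mulrDl lerD//.
  by rewrite normrN hA.
- by move=> x; have := uA x; rewrite /G /A'; lra.
- move=> e /madh[n [q [n0 nq le]]]; exists n, q; split=> //.
  rewrite birkhoffD birkhoff_coboundary nq subrr addr0 birkhoffB birkhoff_cst.
  by move: le; rewrite mulrBl; lra.
Qed.

Definition num_words N := #|{ffun 'I_N -> 'I_k}|.

(** Pigeonhole on the words of length N read along the orbit. Among all
    repetitions of a word the shortest in time is taken, so that the words read
    strictly in between are pairwise distinct. *)
Lemma minimal_return x N : exists i d, [/\ (0 < d)%N, (i + d <= num_words N)%N,
  agree N (iter i sigma x) (iter (i + d) sigma x) &
  forall a b, (a < b < d)%N ->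
    ~ agree N (iter (i + a) sigma x) (iter (i + b) sigma x)].
Proof.
pose word (j : 'I_(num_words N).+1) :=
  [ffun i : 'I_N => sft_coord (iter j sigma x) i].
have ninj : ~ injective word.
  by move=> /leq_card; rewrite card_ord /num_words ltnn.
have [i [j [ij wij]]] : exists i j : 'I_(num_words N).+1,
    (i < j)%N /\ word i = word j.
  apply: contrapT => no; apply: ninj => i j wij; apply: val_inj.
  case: (ltngtP (i : nat) j) => // lt; exfalso; apply: no.
    by exists i, j.
  by exists j, i.
pose P d := `[< exists i, [/\ (0 < d)%N, (i + d <= num_words N)%N &
  agree N (iter i sigma x) (iter (i + d) sigma x)] >].
have exP : exists d, P d.
  exists (j - i)%N; apply/asboolP; exists (val i).
  rewrite /= subnKC ?(ltnW ij)// subn_gt0.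
  split=> //; first by rewrite -ltnS ltn_ord.
  move=> r rN.
  by have /ffunP/(_ (Ordinal rN)) := wij; rewrite !ffunE.
case: (ex_minnP exP) => d /asboolP[a' [d0' ad' ret']] dmin.
exists a', d; split=> // b c /andP[bc cd] agr.
suff /dmin : P (c - b)%N by lia.
apply/asboolP; exists (a' + b)%N; rewrite subn_gt0 bc.
by rewrite -addnA subnKC ?(ltnW bc)//; split=> //; lia.
Qed.

(** On a periodic orbit of tiny average some segment of prescribed length
    num_words N + 1 has total at most th^N. A minimal return within that segment
    closes up into a periodic orbit which shadows it, at the cost of one more
    distortion term of size th^N. *)
Lemma short_light_orbit G C N : (0 < N)%N -> cyl_holder th C G ->
  (forall x, 0 <= G x) ->
  (forall e, 0 < e -> exists n p, [/\ (0 < n)%N, iter n sigma p = p &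
      S G n p <= e * n%:R]) ->
  exists n p, [/\ (0 < n)%N, iter n sigma p = p,
    forall a b, (a < b < n)%N -> ~ agree N (iter a sigma p) (iter b sigma p) &
    S G n p <= (C * geom_tail th + 1) * th ^+ N].
Proof.
move=> N0 hG G0 light.
have thN : 0 < th ^+ N by rewrite exprn_gt0.
pose w := (num_words N).+1.
have w0 : 0 < w%:R :> R by rewrite ltr0n.
(* Otherwise every block of length w would carry more than th^N, and w n steps
   along q, which are both n blocks and w periods, would weigh too much. *)
have [x xle] : exists x, S G w x <= th ^+ N.
  apply: contrapT => no.
  have big x : th ^+ N <= S G w x.
    by rewrite leNgt; apply/negP => /ltW ?; apply: no; exists x.
  have [|n [q [n0 nq le]]] := light (th ^+ N / w%:R / 2).
    by rewrite !divr_gt0.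
  have blocks j y : th ^+ N * j%:R <= S G (j * w) y.
    elim: j y => [|j IH] y; first by rewrite mul0n birkhoff0 mulr0.
    by rewrite mulSn birkhoff_cat -natr1 mulrDr mulr1 addrC lerD.
  have per j : S G (j * n) q = j%:R * S G n q.
    elim: j => [|j IH]; first by rewrite mul0n birkhoff0 mul0r.
    by rewrite mulSn birkhoff_cat nq IH -natr1 mulrDl mul1r addrC.
  have := blocks n q; rewrite mulnC per => /le_trans.
  move=> /(_ (w%:R * (th ^+ N / w%:R / 2 * n%:R))).
  rewrite ler_wpM2l ?(ltW w0)// => /(_ isT).
  rewrite (_ : _ * (_ * n%:R) = th ^+ N * n%:R / 2); last first.
    by field; rewrite gt_eqF.
  have : 0 < th ^+ N * n%:R by rewrite mulr_gt0// ltr0n.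
  lra.
have [i [d [d0 idw ret dist]]] := minimal_return x N.
rewrite addnC iterD in ret.
have [p [dp py]] := close_return d0 N0 ret.
exists d, p; split=> //.
  move=> a b abd pab; apply: (dist a b abd).
  have shadow c : (c < d)%N ->
      agree N (iter c sigma p) (iter (i + c) sigma x).
    move=> cd; rewrite addnC iterD; apply: agree_iter.
    by apply: agree_le py; lia.
  apply: agree_trans (agreeC (shadow a _)) (agree_trans pab (shadow b _)); lia.
rewrite mulrDl mul1r -lerBlDr.
have := birkhoff_distortion th0 th1 hG py; rewrite ler_norml => /andP[_].
apply: le_trans; rewrite lerB//; apply: le_trans xle.
apply: (@le_trans _ _ (S G (i + d) x)).
  by rewrite birkhoff_cat lerDr birkhoff_ge0.
by apply: ler_birkhoff_len => //; rewrite /w; lia.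
Qed.

End SubAction.

(** * Shadowing a periodic orbit and paying for excursions *)

Section Locking.
Context (R : realType) (k : nat) (M : 'M[bool]_k).
Context (ne : exists x, admissible M x) (lam : R) (hlam : 1 < lam).
Local Notation X := (sft ne hlam).
Local Notation sigma := (sft_shift ne hlam).
Local Notation S := (birkhoff sigma).
Implicit Types (x y z q : X) (A F u : X -> R).

(** Cylinders of length N + 1 around the orbit: after one shift, N symbols are
    still shared with the next point of the orbit, and N symbols are enough to
    tell its points apart. *)
Definition orbit_nbhd (p : X) N : set X :=
  [set x | exists j, agree N.+1 x (iter j sigma p)].

Definition off_orbit p N : X -> R := \1_(~` orbit_nbhd p N).

Lemma off_orbit_in p N x : orbit_nbhd p N x -> off_orbit p N x = 0.
Proof. by move=> Ux; rewrite /off_orbit indicE memNset// => /(_ Ux). Qed.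

Lemma off_orbit_notin p N x : ~ orbit_nbhd p N x -> off_orbit p N x = 1.
Proof. by move=> Ux; rewrite /off_orbit indicE mem_set. Qed.

Lemma off_orbit_ge0 p N x : 0 <= off_orbit p N x.
Proof. by rewrite /off_orbit indicE. Qed.

Lemma off_orbit_le1 p N x : off_orbit p N x <= 1.
Proof. by rewrite /off_orbit indicE; case: (_ \in _); rewrite ?lexx ?ler01. Qed.

Context (p : X) (n N : nat).
Context (n0 : (0 < n)%N) (np : iter n sigma p = p).
Context (dist : forall a b, (a < b < n)%N ->
  ~ agree N (iter a sigma p) (iter b sigma p)).
Local Notation U := (orbit_nbhd p N).
Local Notation g := (off_orbit p N).

Lemma orbit_nbhd_orbit j : U (iter j sigma p).
Proof. by exists j; exact: agree_refl. Qed.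

Lemma orbit_separated i j : agree N (iter i sigma p) (iter j sigma p) ->
  iter i sigma p = iter j sigma p.
Proof.
have red l : iter l sigma p = iter (l %% n) sigma p.
  by rewrite {1}(divn_eq l n) addnC iterD iter_mul_periodic.
rewrite (red i) (red j); set a := (i %% n)%N; set b := (j %% n)%N.
have an : (a < n)%N by exact: ltn_pmod.
have bn : (b < n)%N by exact: ltn_pmod.
case: (ltngtP a b) => [ab|ba|->//] agr; exfalso.
  by apply: (dist (a := a) (b := b)) => //; rewrite ab.
by apply: (dist (a := b) (b := a)) (agreeC agr); rewrite ba.
Qed.

(** Points of the orbit being separated by N symbols, the point shadowed at time
    i + 1 is forced to be the image of the one shadowed at time i. *)
Lemma shadow b x : (forall i, (i <= b)%N -> U (iter i sigma x)) ->
  exists j, agree (b.+1 + N) x (iter j sigma p).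
Proof.
elim: b x => [|b IH] x xU; first by have := xU 0%N isT.
have [|j sxj] := IH (sigma x); first by move=> i ib; rewrite -iterSr; exact: xU.
have [i xi] := xU 0%N isT; exists i.
suff E : iter j sigma p = iter i.+1 sigma p.
  apply: agreeS; first exact: agree_le xi.
  by rewrite -iterS -E.
apply: orbit_separated; apply: agree_trans (agree_shift xi).
by apply: agreeC; apply: agree_le sxj; rewrite leq_addl.
Qed.

Lemma trapped x : (forall i, U (iter i sigma x)) ->
  exists j, x = iter j sigma p.
Proof.
move=> xU; have [i xi] := xU 0%N; exists i; apply: agree_eq => b.
have [j xj] := shadow (b := b) (fun i _ => xU i).
suff -> : iter i sigma p = iter j sigma p.
  by apply: agree_le xj; rewrite addSn leqW// leq_addr.
apply: orbit_separated; apply: (@agree_trans _ _ _ _ _ _ _ _ x).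
  by apply: agreeC; apply: agree_le xi.
by apply: agree_le xj; rewrite leq_addl.
Qed.

Context (th et CG del c : R) (G f : X -> R).
Context (th0 : 0 < th) (th1 : th < 1) (et0 : 0 < et) (et1 : et < 1).
Context (hG : cyl_holder th CG G) (G0 : forall x, 0 <= G x).
Context (hf : cyl_holder et del f).

Let phi x := G x - f x.
Let avg F := S F n p / n%:R.

Let n0R : 0 < n%:R :> R. Proof. by rewrite ltr0n. Qed.

Let avgM F : avg F * n%:R = S F n p.
Proof. by rewrite /avg divfK// gt_eqF. Qed.

Let del0 : 0 <= del. Proof. exact: cyl_holder_const_ge0 hf. Qed.

Let f_avg x : f x <= avg f + del.
Proof.
rewrite -(ler_pM2r n0R) mulrDl avgM -lerBlDr -mulrBl.
rewrite -(birkhoff_cst sigma _ n p); apply: ler_birkhoff => y.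
have := cyl_holder_osc x y hf.
by rewrite ler_norml => /andP[_]; rewrite lerBlDl addrC -lerBlDl.
Qed.

Let avgB : avg phi = avg G - avg f.
Proof. by rewrite /avg birkhoffB mulrBl. Qed.

Let avgG_le : avg G <= S G n p.
Proof.
rewrite ler_pdivrMr// ler_peMr ?birkhoff_ge0//.
by rewrite ler1n.
Qed.

Let avgG_ge0 : 0 <= avg G.
Proof. by rewrite divr_ge0 ?birkhoff_ge0// ltW. Qed.

(** Complete periods cancel. In the incomplete one, G contributes at least 0
    against at most its total over a period, and f deviates from its average by
    at most del at each step. *)
Lemma orbit_segment b j :
  - (S G n p + n%:R * del) <= S (fun x => phi x - avg phi) b (iter j sigma p).
Proof.
elim/ltn_ind: b j => b IH j.
have [bn|nb] := ltnP b n; last first.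
  rewrite -(subnKC nb) birkhoff_cat -iterD birkhoffB birkhoff_cst.
  rewrite birkhoff_periodic// avgM subrr add0r; apply: IH.
  by rewrite -subn_gt0 subKn.
rewrite birkhoffB birkhoff_cst birkhoffB avgB.
have : S f b (iter j sigma p) <= (avg f + del) * b%:R.
  by rewrite -(birkhoff_cst sigma _ b (iter j sigma p)) ler_birkhoff.
have : avg G * b%:R <= S G n p.
  by rewrite -(avgM G) ler_wpM2l// ler_nat ltnW.
have : del * b%:R <= n%:R * del by rewrite mulrC ler_wpM2r// ler_nat ltnW.
have := birkhoff_ge0 sigma b (iter j sigma p) G0.
rewrite mulrDl mulrBl; lra.
Qed.

(** A bound on how much a stay near the orbit can beat the orbit average: two
    distortion terms, for G and for f, and one incomplete period. *)
Definition shadowing_loss :=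
  CG * geom_tail th * th ^+ N + del * geom_tail et * et ^+ N
  + (S G n p + n%:R * del).

Lemma shadowing_loss_ge0 : 0 <= shadowing_loss.
Proof.
have CG0 := cyl_holder_const_ge0 hG.
rewrite /shadowing_loss.
have T := mulr_ge0 CG0 (geom_tail_ge0 th0 th1).
have T' := mulr_ge0 del0 (geom_tail_ge0 et0 et1).
rewrite !addr_ge0 ?birkhoff_ge0//; last exact: mulr_ge0.
- exact/(mulr_ge0 T)/exprn_ge0/ltW.
- exact/(mulr_ge0 T')/exprn_ge0/ltW.
Qed.

Lemma near_orbit_segment b x : (forall i, (i < b)%N -> U (iter i sigma x)) ->
  - shadowing_loss <= S (fun y => phi y - avg phi) b x.
Proof.
case: b => [_|b xU]; first by rewrite birkhoff0 oppr_le0 shadowing_loss_ge0.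
have [j xj] := shadow xU.
have := birkhoff_distortion th0 th1 hG xj.
have := birkhoff_distortion et0 et1 hf xj.
have := orbit_segment b.+1 j.
rewrite !ler_norml !birkhoffB !birkhoff_cst /shadowing_loss.
by move=> ? /andP[_ ?] /andP[? _]; lra.
Qed.

Context (cost : shadowing_loss + S G n p + del <= c).

(** Each visit outside the neighbourhood pays c, which covers both its own loss
    and that of the stay near the orbit preceding it. Only the last stay, which
    is not followed by a visit outside, remains unpaid. *)
Lemma excursion_bound b x :
  - shadowing_loss <= S (fun y => phi y - avg phi + c * g y) b x.
Proof.
have c0 : 0 <= c.
  apply: le_trans cost.
  apply: addr_ge0 del0; apply: (addr_ge0 shadowing_loss_ge0).
  exact: birkhoff_ge0.
have seg i y : (forall j, (j < i)%N -> U (iter j sigma y)) ->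
    - shadowing_loss <= S (fun y => phi y - avg phi + c * g y) i y.
  move=> /near_orbit_segment/le_trans; apply; apply: ler_birkhoff => z.
  by rewrite lerDl mulr_ge0 ?off_orbit_ge0.
elim/ltn_ind: b x => b IH x.
have [xU|] := pselect (forall i, (i < b)%N -> U (iter i sigma x)).
  exact: seg.
move=> /existsNP[i0 /not_implyP[i0b xi0]].
pose P i := `[< ~ U (iter i sigma x) >].
have exP : exists i, P i by exists i0; apply/asboolP.
case: (ex_minnP exP) => i /asboolP xi imin.
have ib : (i < b)%N by apply: leq_ltn_trans i0b; apply: imin; apply/asboolP.
have -> : b = (i + (b - i.+1).+1)%N by lia.
rewrite birkhoff_cat birkhoffS off_orbit_notin// mulr1.
have := IH (b - i.+1)%N _ (sigma (iter i sigma x)).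
have -> : (b - i.+1 < b)%N by lia.
move=> /(_ isT).
have : - shadowing_loss <= S (fun y => phi y - avg phi + c * g y) i x.
  apply: seg => j ji; apply: contrapT => xj.
  by move: ji; rewrite ltnNge imin//; apply/asboolP.
have := f_avg (iter i sigma x); have := G0 (iter i sigma x).
move: cost avgG_le; rewrite avgB /phi; lra.
Qed.

End Locking.

Section Gap.
Context (R : realType) (k : nat) (M : 'M[bool]_k).
Context (ne : exists x, admissible M x) (lam : R) (hlam : 1 < lam).
Local Notation X := (sft ne hlam).
Local Notation sigma := (sft_shift ne hlam).
Local Notation S := (birkhoff sigma).

(** Since th < et, a price c of order et^N, affordable in the norm of rate et,
    dominates the losses of order th^N once N is large; del is chosen after N
    and after the period n. Half of the price 2 c covers the losses, the other half
    is the term left in the inequality. *)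
Theorem locking_gap L (th et : R) (A : X -> R) C (e : R) :
  closable ne hlam L -> 0 < th -> th < et -> et < 1 ->
  cyl_holder th C A -> 0 < e ->
  exists (p : X) n N c del, [/\ (0 < n)%N, iter n sigma p = p,
    forall x, (forall i, orbit_nbhd p N (iter i sigma x)) ->
      exists j, x = iter j sigma p,
    0 < c <= e * et ^+ N & 0 < del] /\
    forall F, cyl_holder et del (fun x => F x - (A x - 2 * c * off_orbit p N x)) ->
      exists K, forall b x,
      S F b x + c * S (off_orbit p N) b x <= S F n p / n%:R * b%:R + K.
Proof.
move=> hL th0 the et1 hA e0.
have th1 := lt_trans the et1; have et0 := lt_trans th0 the.
have [m [u [G [CG [GE [bu hu] hG G0 light]]]]] :=
  normalized_potential th0 th1 hL hA.
have CG0 := cyl_holder_const_ge0 hG.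
pose D := CG * geom_tail th + (CG * geom_tail th + 1) * 2.
have D0 : 0 < D.
  have T := mulr_ge0 CG0 (geom_tail_ge0 th0 th1).
  by rewrite /D; lra.
have [N N0 DN] : exists2 N, (0 < N)%N & D * th ^+ N <= e / 2 * et ^+ N.
  have r1 : `|th / et| < 1.
    by rewrite ger0_norm ?divr_ge0 ?ltW// ltr_pdivrMr// mul1r.
  have /cvgr0_norm_le/(_ (e / 2 / D)) := cvg_expr r1.
  rewrite !divr_gt0// => /(_ isT)[N _ /(_ N.+1 (leqnSn N))] /=.
  have r0 : 0 <= th / et by rewrite divr_ge0 ?(ltW th0) ?(ltW et0).
  rewrite ger0_norm ?exprn_ge0// expr_div_n => le.
  exists N.+1 => //.
  by move: le; rewrite ler_pdivrMr ?exprn_gt0// mulrAC ler_pdivlMr// mulrC.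
have [n [p [n0 np dist Glight]]] := short_light_orbit th0 th1 N0 hG G0 light.
have etN : 0 < et ^+ N by rewrite exprn_gt0.
(* del times W bounds every contribution of f to the cost. *)
pose W := geom_tail et * et ^+ N + n%:R + 1.
have W0 : 0 < W.
  have := mulr_ge0 (geom_tail_ge0 et0 et1) (ltW etN).
  by rewrite /W; have := ler0n R n; lra.
pose c := e * et ^+ N; pose del := e / 2 * et ^+ N / W.
have del0 : 0 < del by rewrite divr_gt0// mulr_gt0// divr_gt0.
exists p, n, N, c, del; split.
  split=> //; first exact: (trapped n0 np dist).
  by rewrite mulr_gt0/=.
move=> F; set f := (X in cyl_holder et del X) => hf.
have cost : shadowing_loss p n N th et CG del G + S G n p + del <= c.
  have : del * W <= e / 2 * et ^+ N by rewrite /del divfK// gt_eqF.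
  move: DN Glight; rewrite /shadowing_loss /D /c /W.
  rewrite [(CG * _ + _ * 2) * _]mulrDl; lra.
exists (shadowing_loss p n N th et CG del G + 2 * bu) => b x.
have FE y : F y = m - (G y - f y) + (u (sigma y) - u y)
    - 2 * (c * off_orbit p N y).
  by rewrite GE /f; ring.
have gp : S (off_orbit p N) n p = 0.
  apply: big1 => i _; apply: off_orbit_in; exact: orbit_nbhd_orbit.
have SF j y : S F j y = m * j%:R - S (fun z => G z - f z) j y
    + (u (iter j sigma y) - u y) - 2 * (c * S (off_orbit p N) j y).
  rewrite -birkhoff_coboundary -(birkhoff_cst sigma m j y) -!birkhoffZ.
  rewrite -birkhoffB -birkhoffD -birkhoffB.
  by apply: eq_bigr => i _; rewrite FE.
have := excursion_bound n0 np dist th0 th1 et0 et1 hG G0 hf cost b x.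
rewrite birkhoffD birkhoffB birkhoff_cst birkhoffZ !SF np gp.
have := hu x; have := hu (iter b sigma x); rewrite !ler_norml.
rewrite subrr addr0 !mulr0 subr0 mulrBl mulfK ?gt_eqF ?ltr0n//.
by move=> /andP[? ?] /andP[? ?]; rewrite mulrBl; lra.
Qed.

End Gap.

(** * From Birkhoff sums to invariant measures *)

Section BoundedIntegrals.
Context d (T : measurableType d) (R : realType) (mu : probability T R).
Implicit Types (F : T -> R).

Lemma bounded_integrable F b : measurable_fun setT F ->
  (forall x, `|F x| <= b) -> mu.-integrable setT (EFin \o F).
Proof.
move=> mF Fb; apply: measurable_bounded_integrable => //.
  by rewrite [X in (X < _)%E](probability_setT mu) ltry.
exists b; split; first by rewrite num_real.
by move=> c bc x _; apply: le_trans (Fb x) _; exact: ltW.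
Qed.

Lemma Rintegral_prob_cst c : \int[mu]_x (cst c x) = c.
Proof. by rewrite Rintegral_cst// [X in fine X](probability_setT mu) mulr1. Qed.

End BoundedIntegrals.

Section InvariantIntegrals.
Context d (T : measurableType d) (R : realType) (f : T -> T).
Context (mf : measurable_fun setT f).
Context (mu : probability T R) (muf : invariant_measure f mu).
Implicit Types (F : T -> R).
Local Notation S := (birkhoff f).

Lemma measurable_iter i : measurable_fun setT (iter i f).
Proof.
elim: i => [|i IH]; first exact: measurable_id.
exact: (measurableT_comp mf IH).
Qed.

Lemma Rintegral_invariant F b : measurable_fun setT F ->
  (forall x, `|F x| <= b) -> \int[mu]_x F (f x) = \int[mu]_x F x.
Proof.
move=> mF Fb; rewrite /Rintegral; congr fine.
have iFf : mu.-integrable setT ((EFin \o F) \o f).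
  apply: (@bounded_integrable _ _ _ _ _ b) => //.
  exact: (measurableT_comp mF mf).
have mF' := (measurable_EFinP setT F).2 mF.
apply: etrans (esym (integral_pushforward mf mF' iFf measurableT)) _.
apply: eq_measure_integral => A mA _; exact: muf.
Qed.

Lemma iter_Rintegral_invariant F b i : measurable_fun setT F ->
  (forall x, `|F x| <= b) -> \int[mu]_x F (iter i f x) = \int[mu]_x F x.
Proof.
move=> mF Fb; elim: i => [//|i IH].
have mFi : measurable_fun setT (F \o iter i f).
  exact: measurableT_comp (measurable_iter i).
rewrite -IH -[RHS](Rintegral_invariant mFi (fun x => Fb (iter i f x))).
by apply: eq_Rintegral => x _ /=; rewrite -iterSr.
Qed.

Lemma birkhoff_bounded F b n x : (forall y, `|F y| <= b) ->
  `|S F n x| <= b * n%:R.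
Proof.
move=> Fb; rewrite -(birkhoff_cst f _ _ x) (le_trans (ler_norm_sum _ _ _))//.
exact: ler_sum.
Qed.

Lemma measurable_birkhoff F n : measurable_fun setT F ->
  measurable_fun setT (S F n).
Proof.
move=> mF; apply: measurable_sum => i.
exact: measurableT_comp (measurable_iter i).
Qed.

Lemma Rintegral_birkhoff F b n : measurable_fun setT F ->
  (forall x, `|F x| <= b) ->
  \int[mu]_x S F n x = n%:R * \int[mu]_x F x.
Proof.
move=> mF Fb; elim: n => [|n IH].
  rewrite mul0r -[RHS](Rintegral_prob_cst mu).
  by apply: eq_Rintegral => x _; exact: birkhoff0.
transitivity (\int[mu]_x (S F n x + F (iter n f x))).
  by apply: eq_Rintegral => x _; exact: birkhoffSr.
rewrite RintegralD//.
- by rewrite IH (iter_Rintegral_invariant _ mF Fb) -natr1 mulrDl mul1r.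
- apply: (bounded_integrable mu (measurable_birkhoff n mF)) => x.
  exact: birkhoff_bounded.
- apply: (@bounded_integrable _ _ _ _ _ b) => //.
  exact: measurableT_comp (measurable_iter n).
Qed.

End InvariantIntegrals.

Section OrbitMeasure.
Context d (T : measurableType d) (R : realType) (f : T -> T).
Context (p : T) (n : nat).
Implicit Types (F : T -> R).
Local Notation S := (birkhoff f).
Local Notation nu := (orbit_probability R f p n).

Lemma orbit_probabilityE Y : nu Y = (S \1_Y n.+1 p / n.+1%:R)%:E.
Proof.
transitivity (((n.+1%:R : R)^-1)%:E * \sum_(i < n.+1) (\1_Y (iter i f p) : R)%:E)%E.
  by [].
by rewrite sumEFin -EFinM mulrC.
Qed.

Lemma orbit_invariant : iter n.+1 f p = p -> invariant_measure f nu.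
Proof.
move=> np Y mY; rewrite !orbit_probabilityE; congr (_ / _)%:E.
by rewrite -[RHS](birkhoff_periodic _ np 1) /birkhoff; apply: eq_bigr => i _;
  rewrite -iterSr/= !indicE.
Qed.

(** The integration formulas for sums and multiples of measures concern
    nonnegative functions, hence the detour through F + b. *)
Lemma Rintegral_orbit F b : measurable_fun setT F ->
  (forall x, `|F x| <= b) -> \int[nu]_x F x = S F n.+1 p / n.+1%:R.
Proof.
move=> mF Fb.
have iF := bounded_integrable nu mF Fb.
have : \int[nu]_x (F x + b) = \int[nu]_x F x + b.
  rewrite RintegralD//; last exact: finite_measure_integrable_cst.
  by rewrite (Rintegral_prob_cst nu b).
suff -> : \int[nu]_x (F x + b) = S F n.+1 p / n.+1%:R + b by move/addIr.
rewrite /Rintegral /orbit_probability/= /orbit_measure.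
have F0 x : 0 <= F x + b by have := Fb x; rewrite ler_norml; lra.
have mFb : measurable_fun setT (fun x => (F x + b)%:E).
  by apply/measurable_EFinP; apply: measurable_funD.
rewrite ge0_integral_mscale//; last by move=> x _; rewrite lee_fin.
rewrite ge0_integral_measure_sum//; last by move=> x _; rewrite lee_fin.
under eq_bigr do rewrite integral_dirac// diracT mul1e.
rewrite sumEFin -EFinM/= -/(birkhoff f (fun x => F x + b) n.+1 p).
by rewrite birkhoffD birkhoff_cst mulrC mulrDl mulfK// pnatr_eq0.
Qed.

End OrbitMeasure.

Section UniqueMaximizing.
Context d (T : measurableType d) (R : realType) (f : T -> T).
Context (mf : measurable_fun setT f).
Context (p : T) (n : nat) (F : T -> R) (V : set T) (b c K : R).
Context (mF : measurable_fun setT F) (Fb : forall x, `|F x| <= b).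
Context (mV : measurable V) (c0 : 0 < c).
Context (np : iter n.+1 f p = p).
Context (trap : forall x, (forall i, ~ V (iter i f x)) ->
  exists j, x = iter j f p).
Local Notation S := (birkhoff f).
Local Notation nu := (orbit_probability R f p n).
Context (gap : forall j x,
  S F j x + c * S \1_V j x <= S F n.+1 p / n.+1%:R * j%:R + K).

Lemma EFin_Rintegral_bounded (mu : probability T R) :
  (\int[mu]_x (F x)%:E)%E = (\int[mu]_x F x)%:E.
Proof.
rewrite fineK//; apply: integrable_fin_num => //.
exact: bounded_integrable Fb.
Qed.

Lemma indic_bounded (Y : set T) (x : T) : `|\1_Y x : R| <= 1.
Proof. by rewrite indicE; case: (_ \in _); rewrite ?normr1 ?normr0. Qed.

(** Integrating the pointwise inequality at time j and dividing by j makes the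
    bounded error K disappear. *)
Lemma integral_gap (mu : probability T R) : invariant_measure f mu ->
  \int[mu]_x F x + c * \int[mu]_x \1_V x <= \int[nu]_x F x.
Proof.
move=> muf; rewrite (Rintegral_orbit f p n mF Fb).
have m1 : measurable_fun setT (\1_V : T -> R) by exact: measurable_indic.
set a := _ / _; set I := _ + _.
have le j : I * j%:R <= a * j%:R + K.
  rewrite mulrC mulrDr mulrCA -(Rintegral_birkhoff mf muf j mF Fb).
  rewrite -(Rintegral_birkhoff mf muf j m1 (indic_bounded V)).
  have i1 : mu.-integrable setT (EFin \o S F j).
    apply: (bounded_integrable mu (measurable_birkhoff mf j mF)) => x.
    exact: birkhoff_bounded.
  have i2 : mu.-integrable setT (EFin \o S \1_V j).
    apply: (bounded_integrable mu (measurable_birkhoff mf j m1)) => x.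
    exact: birkhoff_bounded (indic_bounded V).
  have i3 : mu.-integrable setT (EFin \o (fun x => c * S \1_V j x)).
    by have := integrableZl measurableT c i2; apply: eq_integrable.
  rewrite -RintegralZl// -RintegralD//.
  rewrite -(Rintegral_prob_cst mu (a * j%:R + K)).
  apply: le_Rintegral => //=.
  - by have := integrableD measurableT i1 i3; apply: eq_integrable.
  - exact: finite_measure_integrable_cst.
rewrite leNgt; apply/negP => aI.
have Ia : 0 < I - a by rewrite subr_gt0.
have /archi_boundP : 0 <= `|K| / (I - a) by apply: divr_ge0 => //; exact: ltW.
rewrite ltr_pdivrMr//; set j := Num.bound _.
by have := le j; have := ler_norm K; rewrite mulrBr ![j%:R * _]mulrC; lra.
Qed.

Lemma Rintegral_indic (mu : probability T R) Y : measurable Y ->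
  \int[mu]_x \1_Y x = fine (mu Y).
Proof. by move=> mY; rewrite /Rintegral integral_indic// setIT. Qed.

(** A maximizing measure gives V no mass, so almost every point has an orbit
    avoiding V and belongs to the periodic orbit. The Birkhoff sum over one
    period of the indicator of Y is constant there, equal to n + 1 times the
    orbit measure of Y, and integrating it identifies the two measures. *)
Theorem gap_uniquely_maximizing : uniquely_maximizing f F nu.
Proof.
have nuf : invariant_measure f nu by exact: orbit_invariant.
split.
  split=> // mu muf; rewrite !EFin_Rintegral_bounded lee_fin.
  apply: le_trans (integral_gap muf); rewrite lerDl mulr_ge0 ?(ltW c0)//.
  by apply: Rintegral_ge0 => x _; rewrite indicE.
move=> mu [muf mumax] Y mY.
have V0 : mu V = 0%E.
  have := integral_gap muf; have := mumax _ nuf.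
  rewrite !EFin_Rintegral_bounded lee_fin Rintegral_indic// => le1 le2.
  have : c * fine (mu V) <= 0 by lra.
  rewrite pmulr_rle0// => le3.
  rewrite -[LHS](fineK (fin_num_measure mu _ mV)).
  by congr (_%:E); apply/eqP; rewrite eq_le le3 fine_ge0.
have ae : mu.-negligible (\bigcup_i (iter i f @^-1` V)).
  apply: negligible_bigcup => i; exists (iter i f @^-1` V); split=> //.
    by rewrite -[X in measurable X]setTI; exact: measurable_iter.
  elim: i => [//|i IH]; rewrite -[RHS]IH.
  have mi : measurable (iter i f @^-1` V).
    by rewrite -[X in measurable X]setTI; exact: measurable_iter.
  rewrite -[RHS](muf _ mi); congr (mu _).
  by apply/seteqP; split=> x /=; rewrite -iterSr.
have m1 : measurable_fun setT (\1_Y : T -> R) by exact: measurable_indic.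
have : \int[mu]_x S \1_Y n.+1 x = \int[mu]_x (cst (S \1_Y n.+1 p) x).
  congr fine; apply: ae_eq_integral => //.
  - exact/measurable_EFinP/measurable_birkhoff.
  - exact/measurable_EFinP/measurable_cst.
  - apply: negligibleS ae => x /= H; apply: contrapT => nV; apply: H => _.
    have [|j ->] := @trap x.
      by move=> i Vi; apply: nV; exists i.
    by rewrite birkhoff_periodic.
rewrite (Rintegral_birkhoff mf muf _ m1 (indic_bounded Y)).
rewrite (Rintegral_prob_cst mu) (Rintegral_indic _ mY) orbit_probabilityE => <-.
by rewrite mulrC mulKf ?pnatr_eq0// (fineK (fin_num_measure mu _ mY)).
Qed.

End UniqueMaximizing.

(** * Holder functions, measurability and pressure on the subshift *)

Section HolderCylinder.
Context (R : realType) (k : nat) (M : 'M[bool]_k).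
Context (ne : exists x, admissible M x) (lam : R) (hlam : 1 < lam).
Local Notation X := (sft ne hlam).
Local Notation sigma := (sft_shift ne hlam).
Implicit Types (x y : X) (A : X -> R) (a : R).

Let lam0 : 0 < lam. Proof. exact: lt_trans hlam. Qed.

Definition holder_rate a := lam `^ (- a).

Lemma holder_rate_gt0 a : 0 < holder_rate a.
Proof. exact: powR_gt0. Qed.

Lemma holder_rate_lt a c : a < c -> holder_rate c < holder_rate a.
Proof.
move=> ac; rewrite /holder_rate /powR gt_eqF// ltr_expR.
by rewrite ltr_pM2r ?ln_gt0// ltrN2.
Qed.

Lemma holder_rate_lt1 a : 0 < a -> holder_rate a < 1.
Proof. by move=> /holder_rate_lt; rewrite {2}/holder_rate oppr0 powRr0. Qed.

Lemma powR_mdist a n : (lam ^- n) `^ a = holder_rate a ^+ n.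
Proof.
rewrite -(powR_mulrn n (powR_ge0 _ _)) -powRrM -(powR_mulrn n (ltW lam0)).
by rewrite -powRN -powRrM; congr (_ `^ _); ring.
Qed.

Lemma mdist_agree x y : x <> y -> exists n, agree n x y /\ mdist x y = lam ^- n.
Proof.
move=> xy; rewrite /mdist/= /sft_dist; case: pselect => [h|h]; last first.
  exfalso; apply: xy; apply: sft_coord_inj => i; apply/eqP/negPn/negP => xyi.
  by apply: h; exists i.
case: ex_minnP => n _ nmin; exists n; split=> // i ni.
by apply/eqP/negPn/negP => /nmin; rewrite leqNgt ni.
Qed.

Lemma holder_cyl_holder a A : 0 < a -> is_holder a A ->
  cyl_holder (holder_rate a) (Hold a A) A.
Proof.
move=> a0 hA n x y xy.
have H0 : 0 <= Hold a A by apply: fsup_ge0 hA => u; exact: holder_quotient_ge0.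
have [->|/eqP xNy] := eqVneq x y.
  by rewrite subrr normr0 mulr_ge0// exprn_ge0// ltW// holder_rate_gt0.
have d0 : 0 < mdist x y.
  by rewrite lt_def mdist_ge0 andbT; apply/eqP => /mdist_positivity.
have dn : mdist x y <= lam ^- n by exact: sft_dist_le xy.
have := @fsup_ge R _ (@holder_pairs R X) (holder_quotient a A) (x, y) hA.
rewrite /holder_pairs/= d0 mdist_sft_le1 => /(_ isT).
rewrite /holder_quotient/= ler_pdivrMr ?powR_gt0// => /le_trans; apply.
rewrite ler_wpM2l// -powR_mdist ge0_ler_powR ?nnegrE ?mdist_ge0 ?(ltW a0)//.
by rewrite invr_ge0 exprn_ge0 ?ltW.
Qed.

Lemma cyl_holder_quotient a C A u : cyl_holder (holder_rate a) C A ->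
  holder_pairs u -> holder_quotient a A u <= C.
Proof.
case: u => x y hA /= /andP[d0 _].
have xy : x <> y.
  by move=> xy; move: d0; rewrite xy mdistxx ltxx.
have [n [nxy dE]] := mdist_agree xy.
rewrite /holder_quotient/= ler_pdivrMr ?powR_gt0// dE powR_mdist.
exact: hA.
Qed.

Lemma cyl_holder_is_holder a C A : cyl_holder (holder_rate a) C A ->
  is_holder a A.
Proof. by move=> hA; exists C => _ [u Du <-]; exact: cyl_holder_quotient. Qed.

Lemma cyl_holder_Hold a C A : cyl_holder (holder_rate a) C A -> Hold a A <= C.
Proof.
move=> hA; apply: fsup_le; first exact: cyl_holder_const_ge0 hA.
by move=> u Du; exact: cyl_holder_quotient.
Qed.

Lemma cyl_holder_off_orbit th p N : 0 < th -> th < 1 ->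
  cyl_holder th (th ^- N) (off_orbit p N : X -> R).
Proof.
move=> th0 th1 n x y xy.
have [Nn|nN] := ltnP N n.
  have sub (z t : X) : agree n z t -> orbit_nbhd p N z -> orbit_nbhd p N t.
    move=> zt [j zj]; exists j; apply: agree_trans zj.
    by apply: agreeC; apply: agree_le zt.
  have -> : off_orbit p N x = off_orbit p N y.
    rewrite /off_orbit !indicE; congr ((nat_of_bool _)%:R).
    apply/idP/idP; rewrite !inE/=.
      by move=> xV /(sub _ _ (agreeC xy)).
    by move=> yV /(sub _ _ xy).
  by rewrite subrr normr0 mulr_ge0 ?invr_ge0 ?exprn_ge0 ?(ltW th0).
apply: (@le_trans _ _ 1).
  have := (off_orbit_ge0 p N x, off_orbit_ge0 p N y).
  have := (off_orbit_le1 p N x, off_orbit_le1 p N y).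
  by move=> [? ?] [? ?]; rewrite ler_norml; lra.
rewrite mulrC ler_pdivlMr ?exprn_gt0// mul1r.
by apply: ler_wiXn2l => //; exact: ltW.
Qed.

End HolderCylinder.

Section Measurability.
Context (R : realType) (k : nat) (M : 'M[bool]_k).
Context (ne : exists x, admissible M x) (lam : R) (hlam : 1 < lam).
Local Notation X := (sft ne hlam).
Local Notation sigma := (sft_shift ne hlam).
Implicit Types (x y : X) (A : X -> R).

Lemma open_agree (U : set X) x : open U -> U x ->
  exists n, forall y, agree n x y -> U y.
Proof.
have lam0 : 0 < lam by exact: lt_trans hlam.
rewrite openE => oU /oU/nbhs_ballP[e /= e0 eU].
have r1 : `|lam^-1| < 1 by rewrite ger0_norm ?invf_lt1 ?invr_ge0 ?ltW.
have /cvgr0_norm_lt/(_ e e0)[n _ /(_ n (leqnn n))/= ne'] := cvg_expr r1.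
exists n => y xy; apply: eU; rewrite ballEmdist/=.
apply: le_lt_trans (sft_dist_le xy) _.
by move: ne'; rewrite ger0_norm ?exprn_ge0 ?invr_ge0 ?(ltW lam0)// exprVn.
Qed.

Lemma open_measurable_sft (U : set X) : open U -> measurable U.
Proof. exact: sub_sigma_algebra. Qed.

Lemma measurable_shift : measurable_fun setT sigma.
Proof.
apply: (measurability (open : set (set X))) => // _ [U oU <-].
rewrite setTI; apply: open_measurable_sft; apply: agree_open => x Ux.
have [n nU] := open_agree oU Ux.
by exists n.+1 => y xy; apply: nU; exact: agree_shift.
Qed.

Lemma cyl_holder_measurable th C A : 0 < th -> th < 1 -> cyl_holder th C A ->
  measurable_fun setT A.
Proof.
move=> th0 th1 hA; have C0 := cyl_holder_const_ge0 hA.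
apply: (measurability _ (RGenOInfty.measurableE R)) => _ [_ [c ->] <-].
rewrite setTI; apply: open_measurable_sft; apply: agree_open => x.
rewrite /= in_itv/= andbT => cx.
have r1 : `|th| < 1 by rewrite gtr0_norm.
have C1 : 0 < C + 1 by rewrite ltr_wpDl.
have e0 : 0 < (A x - c) / (C + 1) by rewrite divr_gt0 ?subr_gt0.
have /cvgr0_norm_lt/(_ _ e0)[n _ /(_ n (leqnn n))/=] := cvg_expr r1.
rewrite gtr0_norm ?exprn_gt0// ltr_pdivlMr// => lt.
exists n => y /hA; rewrite in_itv/= andbT ler_norml => /andP[_].
have : 0 < th ^+ n by rewrite exprn_gt0.
by move: lt; rewrite mulrDr mulr1 mulrC; lra.
Qed.

Lemma cyl_holder_bounded th C A : cyl_holder th C A ->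
  forall x, `|A x| <= `|A point| + C.
Proof.
move=> hA x; rewrite -lerBlDl (le_trans (lerB_dist _ _))//.
exact: cyl_holder_osc hA.
Qed.

Lemma measurable_off_orbit (p : X) N : measurable (~` orbit_nbhd p N).
Proof.
apply: measurableC; apply: open_measurable_sft; apply: agree_open => x [j xj].
exists N.+1 => y xy; exists j; exact: agree_trans (agreeC xy) xj.
Qed.

End Measurability.

Section Pressure.
Context d (T : measurableType d) (R : realType) (f : T -> T).
Implicit Types (A B : T -> R).

(** Adding a constant to the potential translates the pressure, because the
    measures are probabilities; only this and monotonicity are needed. *)
Lemma pressure_le A B a b c : measurable_fun setT A -> measurable_fun setT B ->
  (forall x, `|A x| <= a) -> (forall x, `|B x| <= b) ->
  (forall x, B x <= A x + c) -> (pressure f B <= pressure f A + c%:E)%E.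
Proof.
move=> mA mB ba bb BA; apply: ge_ereal_sup => _ [mu muf <-].
have iA := bounded_integrable mu mA ba.
have iB := bounded_integrable mu mB bb.
have ic : mu.-integrable setT (EFin \o cst c).
  exact: finite_measure_integrable_cst.
apply: (@le_trans _ _ (entropy f mu + \int[mu]_x (A x)%:E + c%:E)%E).
  rewrite -addeA leeD2l//.
  rewrite -[X in (_ + X%:E)%E](Rintegral_prob_cst mu c).
  rewrite fineK; last exact: integrable_fin_num.
  rewrite -integralD//; apply: le_integral => //.
  - exact: integrableD.
  - by move=> x _; rewrite /= -EFinD lee_fin.
by rewrite leeD2r//; apply: ereal_sup_ubound; exists mu.
Qed.

End Pressure.

(** * Openness and density *)

Section Density.
Context (R : realType) (k : nat) (M : 'M[bool]_k).
Context (ne : exists x, admissible M x) (lam : R) (hlam : 1 < lam).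
Context (alpha : R) (ha : 0 < alpha).
Local Notation X := (sft ne hlam).
Local Notation sigma := (sft_shift ne hlam).
Local Notation C := (@holder R k M ne lam hlam alpha ha).
Local Notation et := (holder_rate lam alpha).

Lemma holder_pressure_le (A B : C) c : (forall x, (B x : R) <= A x + c) ->
  (pressure sigma B <= pressure sigma A + c%:E)%E.
Proof.
have hol (F : C) := holder_cyl_holder ha (holderP F).
have meas (F : C) := cyl_holder_measurable (holder_rate_gt0 hlam alpha)
  (holder_rate_lt1 hlam ha) (hol F).
exact: (pressure_le sigma (meas A) (meas B) (cyl_holder_bounded (hol A))
  (cyl_holder_bounded (hol B))).
Qed.

(** The gap inequality involves F only through oscillations of F minus the
    perturbed potential, so the constant kap is harmless. *)
Lemma near_uniquely_maximizing (A B : C) (kap : R) p n N (c del : R) :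
  0 < c -> iter n.+1 sigma p = p ->
  (forall x, (forall i, orbit_nbhd p N (iter i sigma x)) ->
    exists j, x = iter j sigma p) ->
  (forall F : X -> R,
    cyl_holder et del (fun x => F x - (A x - 2 * c * off_orbit p N x)) ->
    exists K, forall b x,
      birkhoff sigma F b x + c * birkhoff sigma (off_orbit p N) b x <=
      birkhoff sigma F n.+1 p / n.+1%:R * b%:R + K) ->
  (forall x, (B x : R) = A x - 2 * c * off_orbit p N x - kap) ->
  forall F : C, `|F - B| < del ->
    uniquely_maximizing sigma F (orbit_probability R sigma p n).
Proof.
move=> c0 np trap gap BE F FB.
have et0 := holder_rate_gt0 hlam alpha; have et1 := holder_rate_lt1 hlam ha.
have hF := holder_cyl_holder ha (holderP F).
have hf := holder_cyl_holder ha (holderP (F - B)).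
have [|K gapF] := gap F.
  move=> j x y xy; have := hf j x y xy.
  have fE z : (F - B) z = F z - (A z - 2 * c * off_orbit p N z - kap).
    by rewrite -BE.
  rewrite !fE => le.
  rewrite (_ : _ - _ = (F x - (A x - 2 * c * off_orbit p N x - kap))
    - (F y - (A y - 2 * c * off_orbit p N y - kap))); last by ring.
  apply: le_trans le _; rewrite ler_wpM2r ?exprn_ge0 ?(ltW et0)//.
  apply: le_trans (ltW FB); rewrite lerDl; exact: supnorm_ge0.
apply: (gap_uniquely_maximizing (@measurable_shift R k M ne lam hlam)
  (F := F) (V := ~` orbit_nbhd p N) (c := c) (K := K)) => //.
- exact: cyl_holder_measurable hF.
- exact: cyl_holder_bounded hF.
- exact: measurable_off_orbit.
- by move=> x xV; apply: trap => i; apply: contrapT; exact: xV.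
Qed.

Lemma is_holder_cst a (c : R) : is_holder a (fun _ : X => c).
Proof.
by exists 0 => _ [u _ <-]; rewrite /holder_quotient subrr normr0 mul0r.
Qed.

Lemma is_holder_perturbed a (A : X -> R) c kap p N : 0 < a -> is_holder a A ->
  is_holder a (fun x => A x - 2 * c * off_orbit p N x - kap).
Proof.
move=> a0 hA.
have := cyl_holder_off_orbit p N (holder_rate_gt0 hlam a)
  (holder_rate_lt1 hlam a0) => /cyl_holder_is_holder hg.
have := is_holder_lin 1 (is_holder_lin (- (2 * c)) hg hA)
  (@is_holder_cst a (- kap)).
congr is_holder; apply/funext => x; ring.
Qed.

(** The pressure of the perturbed potential is finite by comparison with that of
    A, and it is the constant kap to subtract. *)
Lemma normalized_perturbation (A : C) (c : R) p N : 0 <= c ->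
  pressure sigma A = 0%E ->
  exists (B : C) (kap : R), [/\ `|kap| <= 2 * c, pressure sigma B = 0%E &
    forall x, (B x : R) = A x - 2 * c * off_orbit p N x - kap].
Proof.
move=> c0 PA.
have mk (kap : R) : (fun x => A x - 2 * c * off_orbit p N x - kap) \in
    @holder_pred R k M ne lam hlam alpha.
  by rewrite inE; apply: is_holder_perturbed => //; exact: holderP.
pose B (kap : R) : C := Holder ha (mk kap).
have g01 x : 0 <= 2 * c * off_orbit p N x <= 2 * c.
  rewrite mulr_ge0 ?off_orbit_ge0 ?mulr_ge0//=.
  by rewrite ler_piMr ?off_orbit_le1// mulr_ge0.
have up : (pressure sigma (B 0%R) <= 0)%E.
  rewrite -PA -[leRHS]adde0; apply: (@holder_pressure_le A (B 0) 0) => x /=.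
  by have /andP[] := g01 x; rewrite subr0 addr0; lra.
have lo : (0 <= pressure sigma (B 0%R) + (2 * c)%:E)%E.
  rewrite -PA; apply: holder_pressure_le => x /=.
  by have /andP[] := g01 x; rewrite subr0; lra.
case P0 : (pressure sigma (B 0%R)) up lo => [kap| |]//.
rewrite -EFinD !lee_fin => up lo.
exists (B kap), kap; split=> //; first by rewrite ler_norml; lra.
apply/eqP; rewrite eq_le; apply/andP; split.
  have -> : 0%E = (pressure sigma (B 0%R) + (- kap)%:E)%E.
    by rewrite P0 -EFinD subrr.
  by apply: holder_pressure_le => x /=; rewrite subr0; lra.
have : (pressure sigma (B 0%R) <= pressure sigma (B kap) + kap%:E)%E.
  by apply: holder_pressure_le => x /=; rewrite subr0; lra.
rewrite P0; case: (pressure sigma (B kap)) => [r| |]//.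
by rewrite -EFinD !lee_fin; lra.
Qed.

Lemma perturbation_norm (A B : C) (c kap e : R) p N : 0 <= c ->
  c <= e * et ^+ N -> `|kap| <= 2 * c ->
  (forall x, (B x : R) = A x - 2 * c * off_orbit p N x - kap) ->
  `|A - B| <= 6 * e.
Proof.
move=> c0 ce kapc BE.
have et0 := holder_rate_gt0 hlam alpha; have et1 := holder_rate_lt1 hlam ha.
have etN : et ^+ N <= 1 by rewrite exprn_ile1// ltW.
have etN0 : 0 < et ^+ N by rewrite exprn_gt0.
have ce' : c <= e.
  have e0 : 0 <= e by rewrite -(pmulr_lge0 _ etN0) (le_trans c0).
  by rewrite (le_trans ce)// ler_piMr.
have fE x : (A - B) x = 2 * c * off_orbit p N x + kap :> R.
  have -> : (A - B) x = A x - B x by [].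
  by rewrite BE; ring.
have hold : Hold alpha (A - B) <= 2 * e.
  apply: (@cyl_holder_Hold R k M ne lam hlam) => j x y xy.
  rewrite !fE (_ : _ - _ = 2 * c * (off_orbit p N x - off_orbit p N y)).
    rewrite normrM ger0_norm ?mulr_ge0//.
    have c2 : 0 <= 2 * c by rewrite mulr_ge0.
    have := ler_wpM2l c2 (cyl_holder_off_orbit p N et0 et1 xy).
    move=> /le_trans; apply; rewrite mulrA ler_wpM2r ?exprn_ge0 ?(ltW et0)//.
    by rewrite ler_pdivrMr// -!mulrA ler_wpM2l.
  by ring.
have sup : supnorm (A - B) <= 4 * e.
  apply: (@supnorm_holder_le R k M ne lam hlam alpha ha).
    by rewrite mulr_ge0// (le_trans c0).
  move=> x; rewrite fE (le_trans (ler_normD _ _))//.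
  rewrite ger0_norm ?mulr_ge0 ?off_orbit_ge0//.
  have : 2 * c * off_orbit p N x <= 2 * c.
    by rewrite ler_piMr ?off_orbit_le1// mulr_ge0.
  by lra.
have -> : `|A - B| = Hold alpha (A - B) + supnorm (A - B) by [].
by lra.
Qed.

End Density.

Section Main.
Context (R : realType) (k : nat) (M : 'M[bool]_k).
Context (ne : exists x, admissible M x) (lam : R) (hlam : 1 < lam).
Context (alpha : R) (ha : 0 < alpha).
Local Notation sigma := (sft_shift ne hlam).

Lemma open_G2 : open (G2 ne hlam ha).
Proof.
rewrite openE => A [p [n [np nearA]]].
have := nbhs_interior nearA; apply: filterS => B BA.
by exists p, n.
Qed.

Lemma dense_G2 : topologically_mixing sigma -> dense (G2 ne hlam ha).
Proof.
move=> /mixing_closable[L hL] O [A0 OA0] [W oW WO].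
rewrite -{}WO in OA0 *.
have [e /= e0 eW] : nbhs_ball (set_val A0) W.
  by apply/nbhs_ballP; move: oW; rewrite openE; apply.
have [_ clA0] : holder0_plus ne hlam ha (set_val A0) by exact/set_mem/(valP A0).
have [A [[gam /= gamI [hgam PA]] A0A]] :
    (\bigcup_(gamma in `]alpha, 1]) @holder0_exp R k M ne lam hlam alpha ha gamma)
    `&` ball (set_val A0) (e / 2) !=set0.
  by apply: clA0; apply: nbhsx_ballx; rewrite divr_gt0.
have ag : alpha < gam by move: gamI; rewrite in_itv/= => /andP[].
have g0 := lt_trans ha ag.
have := locking_gap hL (holder_rate_gt0 hlam gam) (holder_rate_lt hlam ag)
  (holder_rate_lt1 hlam ha) (holder_cyl_holder g0 hgam).
(* With c at most (e / 16) lam^(- alpha N), the perturbation has norm at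
   most 6 e / 16, within the remaining half of the ball. *)
move=> /(_ (e / 16)); rewrite divr_gt0// => /(_ isT).
move=> [p [[|n] [N [c [del [[n0 np trap /andP[c0 ce] del0] gap]]]]]] //.
have [B [kap [kapc PB BE]]] := normalized_perturbation p N (ltW c0) PA.
have AB := perturbation_norm (ltW c0) ce kapc BE.
(* The perturbation is locally constant, hence B stays gamma-Holder. *)
have hB : holder0_plus ne hlam ha B.
  split=> //; apply: subset_closure; exists gam => //; split=> //.
  have -> : (B : _ -> R) = (fun x => A x - 2 * c * off_orbit p N x - kap).
    by apply/funext => x; exact: BE.
  exact: is_holder_perturbed.
pose B' : set_type (holder0_plus ne hlam ha) := exist _ B (mem_set hB).
exists B'; split.
  apply: eW; rewrite -ball_normE /=.
  rewrite (_ : _ - _ = (set_val A0 - A) + (A - B)); last by rewrite addrA subrK.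
  rewrite (le_lt_trans (ler_normD _ _))//.
  by move: A0A AB; rewrite -ball_normE/=; lra.
exists p, n; split=> //.
have nB : nbhs (B : @holder R k M ne lam hlam alpha ha)
  [set F | uniquely_maximizing sigma F (orbit_probability R sigma p n)].
  apply/nbhs_ballP; exists del => //= F; rewrite -ball_normE /= distrC => FB.
  exact: (near_uniquely_maximizing c0 np trap gap BE FB).
exact: (@initial_continuous (holder0_plus ne hlam ha)
  (@holder R k M ne lam hlam alpha ha) set_val B' _ nB).
Qed.

End Main.

Theorem theoremB (R : realType) (k : nat) (M : 'M[bool]_k)
    (ne : exists x, admissible M x) (lam : R) (hlam : 1 < lam)
    (mixing : topologically_mixing (sft_shift ne hlam))
    (alpha : R) (ha : 0 < alpha) (ha1 : alpha <= 1) :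
  open (G2 ne hlam ha) /\ dense (G2 ne hlam ha).
Proof. by split; [exact: open_G2|exact: dense_G2]. Qed.
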